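(* Let $m\ge1$ and let $\pi$ be an irreducible cuspidal representation of $\mathrm{GL}_{2m}(\mathbb F)$ which does not admit a Shalika vector. Then $$\gamma(\pi,\wedge^2,\psi)=q^{-\frac m2+2\binom m2}\sum_{\substack{m_1,\dots,m_r\ge1\\ m_1+\dots+m_r=m\\ \lambda_1,\dots,\lambda_r\in\mathbb F^*}}q^{-\sum_{i=1}^r2\binom{m_i}2}\cdot\mathcal B_{\pi,\psi}\left(\mathrm{antidiag}(\lambda_1I_{2m_1},\dots,\lambda_rI_{2m_r})^{-1}\right)\cdot\psi(\lambda_r\cdot\delta_{m_r,1}),$$ where $\delta_{m_r,1}=1$ if $m_r=1$ and $\delta_{m_r,1}=0$ otherwise, and the sum runs over all $r\ge1$, all ordered tuples $(m_1,\dots,m_r)$ of positive integers with sum $m$, and all $(\lambda_1,\dots,\lambda_r)\in(\mathbb F^* )^r$.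
   Context: $\mathbb F$ is a finite field with $q$ elements and $\psi:\mathbb F\to\mathbb C^*$ is a non-trivial additive character. $M=M_m(\mathbb F)$, $G=\mathrm{GL}_m(\mathbb F)$, $\mathcal B\subseteq M$ is the subspace of upper triangular matrices, $N\le G$ the upper triangular unipotent subgroup; $N_n\le\mathrm{GL}_n(\mathbb F)$ is the upper triangular unipotent subgroup and $\psi(u)=\psi(\sum_iu_{i,i+1})$ for $u\in N_n$. $\mathcal S(\mathbb F^m)$ is the space of all functions $\mathbb F^m\to\mathbb C$, and $\mathcal F_\psi\phi(y)=q^{-m/2}\sum_{x}\phi(x)\psi(\langle x,y\rangle)$ with the standard bilinear form. For an irreducible generic representation $\pi$ of $\mathrm{GL}_n(\mathbb F)$ (irreducible cuspidal representations are generic), $\mathcal W(\pi,\psi)$ is its Whittaker model: the functions $g\mapsto\ell(\pi(g)v)$, $v\in V_\pi$, where $0\ne\ell\in\mathrm{Hom}_{N_n}(\pi,\psi)$; $\mathrm{GL}_n(\mathbb F)$ acts by right translation. $\tilde W(g)=W(w_n\,{}^tg^{-1})\in\mathcal W(\tilde\pi,\psi^{-1})$, where $w_n$ is the matrix with ones on the antidiagonal and $\tilde\pi$ is the contragredient. The Bessel function $\mathcal B_{\pi,\psi}$ is the unique element of $\mathcal W(\pi,\psi)$ with $\mathcal B_{\pi,\psi}(I_n)=1$ and $\mathcal B_{\pi,\psi}(u_1gu_2)=\psi(u_1)\psi(u_2)\mathcal B_{\pi,\psi}(g)$ for all $g\in\mathrm{GL}_n(\mathbb F)$, $u_1,u_2\in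 N_n$. For $g_i\in\mathrm{GL}_{n_i}(\mathbb F)$, $\mathrm{antidiag}(g_1,\dots,g_r)$ is the block matrix with blocks $g_1,\dots,g_r$ on the block antidiagonal, $g_1$ in the top right corner and $g_r$ in the bottom left corner, zeros elsewhere. Jacquet–Shalika integral for $n=2m$: $$J_{\pi,\psi}(W,\phi)=\frac1{[G:N][M:\mathcal B]}\sum_{g\in N\backslash G}\ \sum_{X\in\mathcal B\backslash M}W\left(\sigma_{2m}\begin{pmatrix}I_m&X\\ &I_m\end{pmatrix}\begin{pmatrix}g&\\ &g\end{pmatrix}\right)\psi(-\mathrm{tr}X)\,\phi(\varepsilon g),$$ $\varepsilon=(0,\dots,0,1)$, $\sigma_{2m}$ the permutation matrix whose $j$-th column is $e_{\sigma(j)}$, with $\sigma(j)=2j-1$, $\sigma(m+j)=2j$ for $1\le j\le m$. The dual is $\tilde J_{\pi,\psi}(W,\phi)=J_{\tilde\pi,\psi^{-1}}\left(\tilde\pi\begin{pmatrix}&I_m\\ I_m&\end{pmatrix}\tilde W,\mathcal F_\psi\phi\right)$. A Shalika vector of $\pi$ is $0\ne v\in V_\pi$ with $\pi\begin{pmatrix}g&X\\ &g\end{pmatrix}v=\psi(\mathrm{tr}(Xg^{-1}))v$ for all $g\in\mathrm{GL}_m(\mathbb F)$, $X\in M_m(\mathbb F)$. If the irreducible cuspidal $\pi$ admits no Shalika vector, the exterior square gamma factor $\gamma(\pi,\wedge^2,\psi)\in\mathbb C^*$ is the unique non-zero constant (it exists) such that $\tilde J_{\pi,\psi}(W,\phi)=\gamma(\pi,\wedge^2,\psi)J_{\pi,\psi}(W,\phi)$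 for all $W\in\mathcal W(\pi,\psi)$, $\phi\in\mathcal S(\mathbb F^m)$. *)

(* Defs.v *)
From HB Require Import structures.
From mathcomp Require Import all_boot all_order all_algebra all_fingroup.
From mathcomp Require Import mxrepresentation.
From mathcomp Require Import complex.
From mathcomp Require Import reals.

Set Implicit Arguments.
Unset Strict Implicit.
Unset Printing Implicit Defensive.

Import Order.TTheory GRing.Theory Num.Theory.
Local Open Scope ring_scope.

(* The matrices underlying {'GL_n[F]} have size n.-1.+1 instead of n.  The two
   maps below convert between {'GL_n[F]} and matrices of the true size when
   n > 0; [toGL] is the identity element on a matrix which is not invertible or
   whose size is not n. *)
Definition toGL (F : finFieldType) (n k : nat) (A : 'M[F]_k) : {'GL_n[F]} :=
  insubd (1%g : {'GL_n[F]}) (conform_mx 1%:M A).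

Definition ofGL (F : finFieldType) (n : nat) (g : {'GL_n[F]}) : 'M[F]_n :=
  conform_mx 1%:M (val g).

Arguments toGL {F n k} A.
Arguments ofGL {F n} g.

(* antidiag [:: g_1; ...; g_r] = / 0                       g_1 \
                                 \ antidiag [:: g_2; ...]   0  /         *)
Fixpoint antidiag (F : finFieldType) (s : seq {n : nat & 'M[F]_n}) :
    'M[F]_(sumn [seq tag g | g <- s]) :=
  match s return 'M[F]_(sumn [seq tag g | g <- s]) with
  | [::] => 0
  | g :: s' => castmx (erefl, addnC _ _) (block_mx 0 (tagged g) (antidiag s') 0)
  end.

Definition even_scalar_blocks (F : finFieldType) (ms : seq nat) (la : seq F) :
    seq {n : nat & 'M[F]_n} :=
  [seq Tagged (fun n => 'M[F]_n) (x.2%:M : 'M[F]_(2 * x.1)) | x <- zip ms la].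

Definition upper_unipotent (F : finFieldType) (n : nat) : {set {'GL_n[F]}} :=
  [set g | is_trig_mx (ofGL g)^T & [forall i, ofGL g i i == 1]].

Definition upper_triangular (F : finFieldType) (n : nat) : {set 'M[F]_n} :=
  [set X | is_trig_mx X^T].

Definition parabolic_radical (F : finFieldType) (n k : nat) :
    {set {'GL_n[F]}} :=
  [set g | [forall i : 'I_n, forall j : 'I_n,
     ~~ ((i < k) && (k <= j))%N ==> (ofGL g i j == (i == j)%:R)]].

(* j |-> 2j - 1 and m + j |-> 2j for 1 <= j <= m, with indices shifted to start
   at 0. *)
Definition sigma_fun (m j : nat) : nat :=
  if (j < m)%N then j.*2 else (j - m).*2.+1.

Definition sigma_mx (F : finFieldType) (m : nat) : 'M[F]_(m + m) :=
  \matrix_(i, j) (val i == sigma_fun m j)%:R.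

Definition antidiag1_mx (F : finFieldType) (n : nat) : 'M[F]_n :=
  \matrix_(i, j) (j == rev_ord i)%:R.

Definition epsilon (F : finFieldType) (m : nat) : 'rV[F]_m :=
  \row_j (j.+1 == m)%:R.

Section ExteriorSquare.

Variables (C : numClosedFieldType) (F : finFieldType).
Implicit Type psi : F -> C.

Definition nontrivial_additive_character psi : Prop :=
  [/\ psi 0 = 1, {morph psi : x y / x + y >-> x * y} & exists x, psi x != 1].

Definition char_inv psi : F -> C := fun x => (psi x)^-1.

Definition psi_unip psi (n : nat) (u : {'GL_n[F]}) : C :=
  psi (\sum_(i < n) \sum_(j < n | val j == i.+1) ofGL u i j).

Definition sqrtq : C := sqrtC #|F|%:R.

Definition fourier psi (m : nat) (phi : 'rV[F]_m -> C) (y : 'rV[F]_m) : C :=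
  sqrtq ^- m * \sum_(x : 'rV[F]_m) phi x * psi ((x *m y^T) 0 0).

(* W is only summed over coset representatives: the summand does not depend on
   their choice when W is a Whittaker function for psi.  The group law of
   'M[F]_m, used by [rcosets] in the inner sum, is the addition. *)
Definition JS psi (m : nat) (W : {'GL_(m + m)[F]} -> C) (phi : 'rV[F]_m -> C) :
    C :=
  (#|[set: {'GL_m[F]}] : upper_unipotent F m|%g%:R
     * #|[set: 'M[F]_m] : upper_triangular F m|%g%:R)^-1
  * \sum_(Ng in rcosets (upper_unipotent F m) [set: {'GL_m[F]}])
      \sum_(BX in rcosets (upper_triangular F m) [set: 'M[F]_m])
        let g := ofGL (repr Ng) in
        let X := repr BX in
        W (toGL (sigma_mx F m *m block_mx 1%:M X 0 1%:M *m block_mx g 0 0 g))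
          * psi (- \tr X) * phi (epsilon F m *m g).

Definition tildeW (n : nat) (W : {'GL_n[F]} -> C) (g : {'GL_n[F]}) : C :=
  W (toGL (antidiag1_mx F n *m (invmx (ofGL g))^T)).

Definition right_translate (n : nat) (h : {'GL_n[F]}) (W : {'GL_n[F]} -> C)
    (g : {'GL_n[F]}) : C :=
  W (g * h)%g.

Definition JS_dual psi (m : nat) (W : {'GL_(m + m)[F]} -> C)
    (phi : 'rV[F]_m -> C) : C :=
  JS (char_inv psi)
    (right_translate (toGL (block_mx 0 1%:M 1%:M 0 : 'M[F]_(m + m))) (tildeW W))
    (fourier psi phi).

(* A representation rho of GL_n(F) acts on the left on column vectors, by
   v |-> rho g *m v, and linear forms are row vectors.  The proper parabolic
   radicals of block sizes (k, n - k) are the smallest ones, so that they suffice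
   to define cuspidality. *)
Definition cuspidal (n d : nat)
    (rho : mx_representation C [set: {'GL_n[F]}] d) : Prop :=
  forall k : nat, (0 < k < n)%N -> forall v : 'cV[C]_d,
    (forall u, u \in parabolic_radical F n k -> rho u *m v = v) -> v = 0.

Definition whittaker_functional psi (n d : nat)
    (rho : mx_representation C [set: {'GL_n[F]}] d) (l : 'rV[C]_d) : Prop :=
  forall u, u \in upper_unipotent F n -> l *m rho u = psi_unip psi u *: l.

Definition whittaker_model psi (n d : nat)
    (rho : mx_representation C [set: {'GL_n[F]}] d)
    (W : {'GL_n[F]} -> C) : Prop :=
  exists l : 'rV[C]_d, [/\ l != 0, whittaker_functional psi rho l
    & exists v : 'cV[C]_d, forall g, W g = (l *m (rho g *m v)) 0 0].

Definition bessel_function psi (n d : nat)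
    (rho : mx_representation C [set: {'GL_n[F]}] d)
    (B : {'GL_n[F]} -> C) : Prop :=
  [/\ whittaker_model psi rho B, B 1%g = 1
    & forall u1 g u2, u1 \in upper_unipotent F n -> u2 \in upper_unipotent F n ->
        B (u1 * g * u2)%g = psi_unip psi u1 * psi_unip psi u2 * B g].

Definition shalika_vector psi (m d : nat)
    (rho : mx_representation C [set: {'GL_(m + m)[F]}] d)
    (v : 'cV[C]_d) : Prop :=
  v != 0 /\ forall (g : {'GL_m[F]}) (X : 'M[F]_m),
    rho (toGL (block_mx (ofGL g) X 0 (ofGL g))) *m v
      = psi (\tr (X *m invmx (ofGL g))) *: v.

Definition exterior_square_gamma psi (m d : nat)
    (rho : mx_representation C [set: {'GL_(m + m)[F]}] d) (gamma : C) : Prop :=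
  gamma != 0 /\ forall (W : {'GL_(m + m)[F]} -> C) (phi : 'rV[F]_m -> C),
    whittaker_model psi rho W -> JS_dual psi W phi = gamma * JS psi W phi.

End ExteriorSquare.

Arguments sqrtq : clear implicits.

(* Main.v *)
Require Import Defs.
From HB Require Import structures.
From mathcomp Require Import all_boot all_order all_algebra all_fingroup.
From mathcomp Require Import mxrepresentation.
From mathcomp Require Import complex.
From mathcomp Require Import reals.
From mathcomp Require Import ring zify.

Set Implicit Arguments.
Unset Strict Implicit.
Unset Printing Implicit Defensive.

Import Order.TTheory GRing.Theory Num.Theory.
Local Open Scope ring_scope.

(** The functional equation holds for every pair (W, phi), so gamma can be read
    off from a single pair for which both sides can be computed.  Take for W the
    right translate of the Bessel function B by the inverse of the shuffle
    permutation sigma, and for phi the indicator of epsilon.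

    Put f(A) = B(sigma A sigma^-1) and, for p in GL_m,
      K(p) = sum over X in M_m of f((1 X; 0 1) diag(p, p)) psi(- tr X).
    The sums over X depend only on cosets, so that up to the same factor
    1 / (|GL_m| |M_m|) the integral is the sum of K(g) over the g that fix
    epsilon ([JS_delta]).  In the dual integral, the substitution g -> r g^-T,
    X -> - r X^T r, with r the reversal of the basis, turns the argument of W~
    back into a Shalika matrix and the Fourier transform of phi into an additive
    character of one corner entry of g^-1; after g -> g^-1 it is q^(-m/2) times the sum over all g of
    K(g^-1) psi(g_(m,1)) ([JS_dual_delta]).

    K is invariant under the unitriangular group N on both sides, so by the
    Bruhat decomposition it is enough to know K at p = t^-1, for t the monomial
    matrix with entry c_i at (i, w i).  Conjugating the group of upper
    unitriangular 2m x 2m matrices by sigma^-1 gives explicit unipotent block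
    matrices, and f transforms under them by a character.  Playing two of
    these, U and V, against each other in U h = h V shows two things.

    - f vanishes at (1 X; 0 1) diag(p, p) as soon as X has a nonzero entry in one
      of the nu(w) positions that correspond to pairs i < j with w i < w j
      ([shalika_vanish]).  For the other X the summand of K(p) is f(diag(p, p)),
      so that K(p) = q^(m^2 - nu(w)) f(diag(p, p)) ([shalika_sum_monomial]).

    - f(diag(p, p)) vanishes unless every ascent of w goes to the next value
      and does not change c ([shalika_support]).  Such a t is a block
      antidiagonal matrix with scalar blocks lambda_i 1_(m_i) ([blocks_exist]),
      its nu(w) is the sum of the binomials C(m_i, 2) ([pair_count_block]), and
      f(diag(p, p)) is the value of B at the inverse of the antidiagonal matrix
      with the doubled blocks lambda_i 1_(2 m_i) ([toGL_even_antidiagV]).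

    As |N t N| = q^(2 C(m, 2) - nu(w)) ([card_cell]), summing over the double
    cosets N t N gives the claimed sum, times q^(m^2) ([shalika_sum_total]).
    Among the g that fix epsilon only those in N contribute to the other side,
    which is therefore q^(m^2) ([shalika_sum_mirabolic]). *)

(** * Invertible matrices as elements of the linear group *)

Lemma invmx_mul (F : fieldType) n (A B : 'M[F]_n) : A \in unitmx -> B \in unitmx ->
  invmx (A *m B) = invmx B *m invmx A.
Proof.
move=> uA uB; have uAB : A *m B \in unitmx by rewrite unitmx_mul uA.
apply: (can_inj (mulKmx uAB)).
by rewrite mulmxV // mulmxA -(mulmxA A) mulmxV // mulmx1 mulmxV.
Qed.

Section GLMatrix.
Variables (F : finFieldType) (n : nat).
Hypothesis n_gt0 : (0 < n)%N.
Implicit Types (g h : {'GL_n[F]}) (A : 'M[F]_n).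

Lemma toGLK A : A \in unitmx -> ofGL (toGL A : {'GL_n[F]}) = A.
Proof.
case: n n_gt0 A => // k _ A uA.
by rewrite /ofGL /toGL conform_mx_id insubdK // conform_mx_id.
Qed.

Lemma ofGL_unit g : ofGL g \in unitmx.
Proof.
by case: n n_gt0 g => // k _ g; rewrite /ofGL conform_mx_id (valP g).
Qed.

Lemma ofGL_inj : injective (@ofGL F n).
Proof.
by case: n n_gt0 => // k _ g h; rewrite /ofGL !conform_mx_id => /val_inj.
Qed.

Lemma ofGLK g : toGL (ofGL g) = g.
Proof. by apply: ofGL_inj; rewrite toGLK ?ofGL_unit. Qed.

Lemma ofGLM g h : ofGL (g * h)%g = ofGL g *m ofGL h.
Proof. by case: n n_gt0 g h => // k _ g h; rewrite /ofGL !conform_mx_id. Qed.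

Lemma ofGL1 : ofGL (1%g : {'GL_n[F]}) = 1%:M.
Proof. by case: n n_gt0 => // k _; rewrite /ofGL !conform_mx_id. Qed.

Lemma ofGLV g : ofGL g^-1%g = invmx (ofGL g).
Proof.
apply: (can_inj (mulKmx (ofGL_unit g))).
by rewrite -ofGLM mulgV ofGL1 mulmxV ?ofGL_unit.
Qed.

Lemma toGLM A B : A \in unitmx -> B \in unitmx ->
  (toGL (A *m B) : {'GL_n[F]}) = (toGL A * toGL B)%g.
Proof.
by move=> uA uB; apply: ofGL_inj; rewrite ofGLM !toGLK // unitmx_mul uA.
Qed.

Lemma toGLV A : A \in unitmx -> (toGL (invmx A) : {'GL_n[F]}) = (toGL A)^-1%g.
Proof. by move=> uA; apply: ofGL_inj; rewrite ofGLV !toGLK // unitmx_inv. Qed.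

End GLMatrix.

(** * Triangular matrices *)

Section Triangular.
Variables (F : finFieldType) (n : nat).
Implicit Types A B U : 'M[F]_n.

Definition upper A := forall i j : 'I_n, (j < i)%N -> A i j = 0.
Definition strictly_upper A := forall i j : 'I_n, (j <= i)%N -> A i j = 0.
Definition unitriangular A :=
  forall i j : 'I_n, (j <= i)%N -> A i j = (i == j)%:R.

Lemma unitriangular1 : unitriangular 1%:M.
Proof. by move=> i j _; rewrite mxE. Qed.

Lemma upper0 : upper 0.
Proof. by move=> i j _; rewrite mxE. Qed.

Lemma strictly_upper0 : strictly_upper 0.
Proof. by move=> i j _; rewrite mxE. Qed.

Lemma unitriangularDr A : strictly_upper A -> unitriangular (1%:M + A).
Proof. by move=> sA i j leji; rewrite !mxE sA // addr0. Qed.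

Lemma unitriangular_upper A : unitriangular A -> upper A.
Proof. by move=> uA i j ltji; rewrite uA 1?ltnW // -val_eqE /= gtn_eqF. Qed.

Lemma unitriangular_diag A i : unitriangular A -> A i i = 1.
Proof. by move=> uA; rewrite uA // eqxx. Qed.

Lemma unitriangularM A B :
  unitriangular A -> unitriangular B -> unitriangular (A *m B).
Proof.
move=> uA uB i j leji; rewrite mxE (bigD1 i) //= big1 ?addr0 => [|k neki].
  by rewrite unitriangular_diag // mul1r uB.
have [ltki|leik] := ltnP k i; first by rewrite unitriangular_upper ?mul0r.
rewrite [B k j]unitriangular_upper ?mulr0 //.
by apply: leq_ltn_trans leji _; rewrite ltn_neqAle leik eq_sym andbT.
Qed.

Lemma upperM A B : upper A -> upper B -> upper (A *m B).
Proof.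
move=> uA uB i j ltji; rewrite mxE big1 // => k _.
have [ltki|leik] := ltnP k i; first by rewrite uA ?mul0r.
by rewrite (uB k j) ?mulr0 // (leq_trans ltji).
Qed.

Lemma unitriangular_unitmx A : unitriangular A -> A \in unitmx.
Proof.
move=> uA; rewrite unitmxE -det_tr det_trig.
  by rewrite big1 ?unitr1 // => i _; rewrite mxE unitriangular_diag.
by apply/is_trig_mxP => i j ltij; rewrite mxE unitriangular_upper.
Qed.

Lemma upper_triangularP A : reflect (upper A) (A \in upper_triangular F n).
Proof.
rewrite inE; apply: (iffP is_trig_mxP) => uA i j ltij.
  by have := uA j i ltij; rewrite mxE.
by rewrite mxE uA.
Qed.

Lemma upper_unipotentP (g : {'GL_n[F]}) :
  reflect (unitriangular (ofGL g)) (g \in upper_unipotent F n).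
Proof.
rewrite inE; apply: (iffP andP) => [[/is_trig_mxP tg /forallP dg] i j | ug].
  rewrite leq_eqVlt => /orP[/eqP/val_inj->|ltji]; first by rewrite (eqP (dg i)) eqxx.
  by have := tg j i ltji; rewrite mxE -val_eqE /= gtn_eqF // => ->.
split; last by apply/forallP=> i; rewrite unitriangular_diag.
by apply/is_trig_mxP => i j ltij; rewrite mxE unitriangular_upper.
Qed.

Lemma upper_triangular_group_set : group_set (upper_triangular F n).
Proof.
apply/group_setP; split; first exact/upper_triangularP/upper0.
move=> A B /upper_triangularP uA /upper_triangularP uB.
by apply/upper_triangularP => i j ltji; rewrite mxE uA ?uB ?addr0.
Qed.
Canonical upper_triangular_group := Group upper_triangular_group_set.

End Triangular.

Section UnipotentGroup.
Variables (F : finFieldType) (n : nat).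
Hypothesis n_gt0 : (0 < n)%N.

Lemma upper_unipotent_group_set : group_set (upper_unipotent F n).
Proof.
apply/group_setP; split.
  by apply/upper_unipotentP; rewrite ofGL1 //; apply: unitriangular1.
move=> g h /upper_unipotentP ug /upper_unipotentP uh.
by apply/upper_unipotentP; rewrite ofGLM //; apply: unitriangularM.
Qed.
Definition upper_unipotent_group := Group upper_unipotent_group_set.

End UnipotentGroup.

(** Closure under products is enough inside a finite group. *)
Lemma unitriangular_inv (F : finFieldType) n (A : 'M[F]_n) :
  unitriangular A -> unitriangular (invmx A).
Proof.
case: n A => [|n] A uA; first by case.
have UA := unitriangular_unitmx uA.
have gA : toGL A \in upper_unipotent_group F (ltn0Sn n).
  by apply/upper_unipotentP; rewrite toGLK.
by have /upper_unipotentP := groupVr gA; rewrite ofGLV // toGLK.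
Qed.

Lemma sum_rcosets (C : numFieldType) (gT : finGroupType) (H : {group gT})
    (f : gT -> C) : (forall h x, h \in H -> f (h * x)%g = f x) ->
  \sum_(A in rcosets H [set: gT]) f (repr A) = (#|H|%:R)^-1 * \sum_x f x.
Proof.
move=> fH; have H0 : #|H|%:R != 0 :> C by rewrite pnatr_eq0 -lt0n cardG_gt0.
apply: (canRL (mulKf H0)).
have -> : \sum_x f x = \sum_(x in [set: gT]) f x.
  by apply: eq_bigl => x; rewrite inE.
rewrite (set_partition_big _ (rcosets_partition (subsetT H))) /= mulr_sumr.
apply: eq_bigr => A /rcosetsP[x _ ->].
rewrite -(card_rcoset H x) mulr_natl -sumr_const.
apply: eq_bigr => _ /rcosetP[k Hk ->]; rewrite fH //.
by have /rcosetP[h Hh ->] := mem_repr_rcoset H x; rewrite fH.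
Qed.

(** * Bruhat decomposition *)

Section Monomial.
Variables (F : finFieldType) (n : nat).
Implicit Types (w : 'S_n) (c : 'I_n -> F) (A U V : 'M[F]_n).

Definition monomial w c : 'M[F]_n := \matrix_(i, j) (c i *+ (j == w i)).

Lemma monomial_mull w c (A : 'M[F]_n) i k :
  (monomial w c *m A) i k = c i * A (w i) k.
Proof.
rewrite mxE (bigD1 (w i)) //= big1 ?addr0 => [|j /negbTE nj].
  by rewrite mxE eqxx.
by rewrite mxE nj mulr0n mul0r.
Qed.

Lemma monomial_mulr w c (A : 'M[F]_n) i k :
  (A *m monomial w c) i (w k) = A i k * c k.
Proof.
rewrite mxE (bigD1 k) //= big1 ?addr0 => [|j /negbTE nj].
  by rewrite mxE eqxx.
by rewrite mxE (inj_eq perm_inj) eq_sym nj mulr0n mulr0.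
Qed.

Lemma monomial_unitmx w c : (forall i, c i != 0) -> monomial w c \in unitmx.
Proof.
move=> c0; have : monomial w c *m
    (\matrix_(i, j) ((c j)^-1 *+ (i == w j))) = 1%:M.
  apply/matrixP => i j; rewrite monomial_mull !mxE (inj_eq perm_inj).
  by case: eqP => [->|_]; rewrite ?divff ?mulr0.
by case/mulmx1_unit.
Qed.

Lemma monomial_conj w c A : (forall i, c i != 0) ->
  monomial w c *m A
  = \matrix_(i, j) (c i / c j * A (w i) (w j)) *m monomial w c.
Proof.
move=> c0; apply/matrixP => i k; rewrite monomial_mull -[k](permKV w).
by rewrite monomial_mulr mxE permKV mulrAC divfK.
Qed.

Lemma perm_geid w : (forall i : 'I_n, i <= w i)%N -> w = 1%g.
Proof.
move=> le_w; have le_i (i : 'I_n) : (i <= w i ?= iff (i == w i))%N by split; rewrite ?le_w.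
have [_] := leqif_sum (fun i (_ : true) => le_i i).
rewrite [X in _ == X](reindex_inj (@perm_inj _ w^-1)) /=.
under [X in _ == X]eq_bigr do rewrite permKV.
rewrite eqxx => /esym/forallP eq_w; apply/permP => i; rewrite perm1.
by rewrite [in RHS](eqP (eq_w i)).
Qed.

(** The entry of the two sides at (i, w2 i) shows that row i of [U] does not
    vanish in column w1^-1 (w2 i), so that this index is at least i; a
    permutation that never decreases an index is the identity. *)
Lemma Bruhat_unique w1 w2 c1 c2 U V : unitriangular U -> unitriangular V ->
    (forall i, c2 i != 0) ->
  U *m monomial w1 c1 = monomial w2 c2 *m V -> w1 = w2 /\ c1 =1 c2.
Proof.
move=> uU uV c20 eqUV.
have eq_c i : U i ((w2 * w1^-1)%g i) * c1 ((w2 * w1^-1)%g i) = c2 i.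
  rewrite -(monomial_mulr w1) eqUV monomial_mull permM permKV.
  by rewrite unitriangular_diag ?mulr1.
have w12 : (w2 * w1^-1)%g = 1%g.
  apply: perm_geid => i; rewrite leqNgt; apply/negP => lti.
  by have /eqP := eq_c i; rewrite unitriangular_upper // mul0r eq_sym (negPf (c20 i)).
split=> [|i]; first by rewrite -[w2](mulgKV w1) w12 mul1g.
by have := eq_c i; rewrite w12 perm1 unitriangular_diag // mul1r.
Qed.

End Monomial.

Section Bruhat.
Variable (F : finFieldType).

(** The inverse of passing to a minor, when the deleted row and column have no
    nonzero entry besides the pivot [a].  It is multiplicative ([insert_mxM]),
    which carries the induction step of the Bruhat decomposition. *)
Definition insert_mx n (i0 j0 : 'I_n.+1) (a : F) (A : 'M[F]_n) : 'M[F]_n.+1 :=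
  \matrix_(i, j) (if unlift i0 i is Some k then
                    if unlift j0 j is Some l then A k l else 0
                  else a *+ (j == j0)).

Lemma insert_unitriangular n (i0 : 'I_n.+1) (A : 'M[F]_n) :
  unitriangular A -> unitriangular (insert_mx i0 i0 1 A).
Proof.
move=> uA i j leji; rewrite mxE; case: unliftP => [k|] def_i; last first.
  by rewrite def_i eq_sym.
case: unliftP => [l def_j|->].
  rewrite uA ?def_i ?def_j ?(inj_eq lift_inj) //.
  by move: leji; rewrite def_i def_j /= leq_bump2.
by rewrite def_i eq_sym (negPf (neq_lift _ _)).
Qed.

Lemma insert_mx_pivot n (i0 j0 : 'I_n.+1) a (A : 'M[F]_n) :
  insert_mx i0 j0 a A i0 j0 = a.
Proof. by rewrite mxE unlift_none eqxx. Qed.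

Lemma insert_mx_row n (i0 j0 : 'I_n.+1) a (A : 'M[F]_n) l :
  insert_mx i0 j0 a A i0 (lift j0 l) = 0.
Proof. by rewrite mxE unlift_none eq_sym (negPf (neq_lift _ _)). Qed.

Lemma insert_mx_col n (i0 j0 : 'I_n.+1) a (A : 'M[F]_n) k :
  insert_mx i0 j0 a A (lift i0 k) j0 = 0.
Proof. by rewrite mxE liftK unlift_none. Qed.

Lemma insert_mx_minor n (i0 j0 : 'I_n.+1) a (A : 'M[F]_n) k l :
  insert_mx i0 j0 a A (lift i0 k) (lift j0 l) = A k l.
Proof. by rewrite mxE !liftK. Qed.

Let insert_mxE := (insert_mx_pivot, insert_mx_row, insert_mx_col, insert_mx_minor).

Lemma insert_mxM n (i0 j0 k0 : 'I_n.+1) a b (A B : 'M[F]_n) :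
  insert_mx i0 j0 a A *m insert_mx j0 k0 b B = insert_mx i0 k0 (a * b) (A *m B).
Proof.
apply/matrixP => i k; rewrite [LHS]mxE (bigD1_ord j0) //=.
case: (unliftP i0 i) => [i'|] ->; case: (unliftP k0 k) => [k'|] ->;
  rewrite !insert_mxE ?mulr0 ?mul0r ?add0r.
- by rewrite mxE; apply: eq_bigr => j _; rewrite !insert_mxE.
- by rewrite big1 // => j _; rewrite !insert_mxE mulr0.
- by rewrite big1 // => j _; rewrite !insert_mxE mul0r.
- by rewrite big1 ?addr0 // => j _; rewrite !insert_mxE mul0r.
Qed.

Lemma insert_monomial n (i0 j0 : 'I_n.+1) a (w : 'S_n) (c : 'I_n -> F) :
  insert_mx i0 j0 a (monomial w c)
  = monomial (lift_perm i0 j0 w) (fun i => oapp c a (unlift i0 i)).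
Proof.
apply/matrixP => i k; case: (unliftP i0 i) => [i'|] ->; case: (unliftP j0 k) => [k'|] ->;
  rewrite insert_mxE !mxE ?lift_perm_lift ?lift_perm_id ?liftK ?unlift_none /= ?eqxx //.
- by rewrite (inj_eq lift_inj).
- by rewrite (negPf (neq_lift _ _)).
- by rewrite eq_sym (negPf (neq_lift _ _)).
Qed.

Lemma insert_unitmx n (i0 j0 : 'I_n.+1) a (A : 'M[F]_n) :
  insert_mx i0 j0 a A \in unitmx -> A \in unitmx.
Proof.
rewrite !unitmxE (expand_det_row _ i0) (bigD1_ord j0) //= big1 ?addr0.
  rewrite insert_mx_pivot /cofactor !unitrM => /and3P[_ _].
  suff ->: row' i0 (col' j0 (insert_mx i0 j0 a A)) = A by [].
  by apply/matrixP => k l; rewrite mxE [LHS]mxE insert_mx_minor.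
by move=> l _; rewrite insert_mx_row mul0r.
Qed.

(** Clearing the first column above its lowest nonzero entry [a], and then the
    row of [a], takes row and column operations in the unitriangular group. *)
Lemma insert_mx_reduction n (A : 'M[F]_n.+1) : A \in unitmx ->
  exists i0 a A' U V, [/\ unitriangular U, unitriangular V, a != 0
    & A = U *m insert_mx i0 ord0 a A' *m V].
Proof.
move=> uA.
have /existsP[i1 i1P] : [exists i, A i ord0 != 0].
  apply: contraTT uA => /existsPn A0.
  rewrite unitmxE (expand_det_col _ ord0) big1 ?unitr0 // => i _.
  by rewrite (eqP (negPn (A0 i))) mul0r.
pose i0 := [arg max_(i > i1 | A i ord0 != 0) (i : nat)].
have [a0 maxi0] : A i0 ord0 != 0 /\ forall i : 'I_n.+1, (i0 < i)%N -> A i ord0 = 0.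
  rewrite /i0; case: arg_maxnP => // i a0 maxi; split=> // j ltij.
  by apply/eqP; apply: contraTT ltij => /maxi; rewrite -leqNgt.
pose a := A i0 ord0.
pose u : 'cV[F]_n.+1 := \col_i ((A i ord0 / a) *+ (i != i0)).
pose v : 'rV[F]_n.+1 := \row_j ((A i0 j / a) *+ (j != ord0)).
pose A' : 'M[F]_n := \matrix_(k, l) (A (lift i0 k) (lift ord0 l)
   - A (lift i0 k) ord0 / a * A i0 (lift ord0 l)).
exists i0, a, A', (1%:M + u *m delta_mx 0 i0), (1%:M + delta_mx ord0 0 *m v).
split=> //.
- apply: unitriangularDr => i j leji; rewrite mxE big_ord1 !mxE /=.
  have [ji|_] := eqVneq j i0; last by rewrite mulr0.
  have [//|ne] := eqVneq i i0; first by rewrite mul0r.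
  by rewrite maxi0 ?mul0r // ltn_neqAle eq_sym ne -ji.
- apply: unitriangularDr => i j leji; rewrite mxE big_ord1 !mxE /=.
  have [i00|_] := eqVneq i ord0; last by rewrite mul0r.
  move: leji; rewrite i00 leqn0 => /eqP j0.
  have -> : j = ord0 by apply: val_inj.
  by rewrite eqxx mulr0n mulr0.
rewrite mulmxDl mul1mx -mulmxA -rowE; set M := insert_mx _ _ _ _.
rewrite mulmxDr mulmx1 mulmxA -colE.
have Mi0 j : M i0 j = a *+ (j == ord0).
  by rewrite /M mxE unlift_none.
have outer (x : 'cV[F]_n.+1) (y : 'rV[F]_n.+1) i j : (x *m y) i j = x i 0 * y 0 j.
  by rewrite mxE big_ord1.
have uE i : u i 0 = (A i ord0 / a) *+ (i != i0) by rewrite mxE.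
have vE j : v 0 j = (A i0 j / a) *+ (j != ord0) by rewrite mxE.
have UM i j : (M + u *m row i0 M) i j = M i j + u i 0 * M i0 j.
  by rewrite mxE outer [row _ _ _ _]mxE.
apply/matrixP => i j.
have -> : (M + u *m row i0 M + col ord0 (M + u *m row i0 M) *m v) i j
    = (M + u *m row i0 M) i j + (M + u *m row i0 M) i ord0 * v 0 j.
  by rewrite mxE outer [col _ _ _ _]mxE.
rewrite !UM !Mi0 eqxx mulr1n uE vE.
case: (unliftP i0 i) => [k|] ->; case: (unliftP ord0 j) => [l|] ->;
  rewrite /M ?insert_mxE ?eqxx ?[lift _ _ == _]eq_sym ?(negPf (neq_lift _ _)) /=
  ?mulr0n ?mulr1n ?mulr0 ?mul0r ?addr0 ?add0r ?divfK //.
- by rewrite mxE mulrA [in X in _ = _ - X + _]mulrAC subrK.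
- by rewrite mulrCA divff ?mulr1.
Qed.

Lemma Bruhat_exists n (A : 'M[F]_n) : A \in unitmx ->
  exists w c U V, [/\ unitriangular U, unitriangular V, forall i, c i != 0
    & A = U *m monomial w c *m V].
Proof.
elim: n A => [|n IHn] A uA.
  exists 1%g, (fun=> 1), 1%:M, 1%:M; split; try exact: unitriangular1; first by case.
  by apply/matrixP => -[].
have [i0 [a [A' [U [V [uU uV a0 defA]]]]]] := insert_mx_reduction uA.
have /IHn[w [c [U' [V' [uU' uV' c0 defA']]]]] : A' \in unitmx.
  apply: (@insert_unitmx _ i0 ord0 a).
  by move: uA; rewrite defA !unitmx_mul => /andP[/andP[]].
exists (lift_perm i0 ord0 w), (fun i => oapp c a (unlift i0 i)).
exists (U *m insert_mx i0 i0 1 U'), (insert_mx ord0 ord0 1 V' *m V); split.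
- exact/unitriangularM/insert_unitriangular.
- by apply: unitriangularM => //; apply: insert_unitriangular.
- by move=> i; case: unliftP => [k|] _ /=; [apply: c0 | apply: a0].
by rewrite -insert_monomial defA defA' !mulmxA -!(mulmxA U) !insert_mxM mul1r mulr1.
Qed.

End Bruhat.

(** * Double cosets of the unipotent group *)

Lemma card_prescribed_mx (F : finFieldType) m n (P : pred ('I_m * 'I_n))
    (B : 'M[F]_(m, n)) :
  #|[set A : 'M[F]_(m, n) | [forall p, P p || (A p.1 p.2 == B p.1 p.2)]]|
  = (#|F| ^ #|P|)%N.
Proof.
pose D p : pred F := if P p then predT else pred1 (B p.1 p.2).
pose f (A : 'M[F]_(m, n)) := [ffun p : 'I_m * 'I_n => A p.1 p.2].
pose g (h : {ffun 'I_m * 'I_n -> F}) : 'M[F]_(m, n) := \matrix_(i, j) h (i, j).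
have gK : cancel g f.
  by move=> h; apply/ffunP => -[i j]; rewrite ffunE mxE.
have fK : cancel f g by move=> A; apply/matrixP => i j; rewrite mxE ffunE.
have -> : [set A : 'M[F]_(m, n) | [forall p, P p || (A p.1 p.2 == B p.1 p.2)]]
    = [set g h | h in family D].
  apply/setP => A; rewrite inE -{2}(fK A) (mem_imset _ _ (can_inj gK)).
  apply/forallP/familyP => [AP p | AD p].
    by have := AP p; rewrite ffunE /D; case: ifP.
  by have := AD p; rewrite ffunE /D; case: (P p).
rewrite (card_imset _ (can_inj gK)) card_family.
rewrite foldrE big_image /= -prod_nat_const [RHS]big_mkcond /=.
by apply: eq_bigr => p _; rewrite /D unfold_in; case: (P p); rewrite ?card1 // cardT -cardE.
Qed.

Section DoubleRcoset.
Variables (gT : finGroupType) (H : {group gT}).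

Lemma setI_conj_id t : t \in H -> #|(H :&: H :^ t^-1)%g| = #|H|.
Proof. by move=> Ht; rewrite conjGid ?groupV // setIid. Qed.

Lemma card_double_rcoset t :
  (#|H :* t * H|%g * #|(H :&: H :^ t^-1)%g| = #|H| ^ 2)%N.
Proof.
rewrite -mulnn -[X in (_ = _ * X)%N](cardJg H t^-1%g) mul_cardG; congr (_ * _)%N.
rewrite -[RHS](card_rcoset _ t); congr #|pred_of_set _|.
by rewrite /= conjsgE invgK -!mulgA mulg_set1 mulVg mulg1.
Qed.

End DoubleRcoset.

Section DoubleCoset.
Variables (F : finFieldType) (n : nat).
Hypothesis n_gt0 : (0 < n)%N.
Implicit Types (w : 'S_n) (c : 'I_n -> F).

Definition noninversion w := fun p : 'I_n * 'I_n => (p.1 < p.2)%N && (w p.1 < w p.2)%N.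

Let N := upper_unipotent_group F n_gt0.

(** Membership of [u] in the conjugate of N constrains the entries whose position
    is carried by [w] to the diagonal or below; the entries that stay free are
    those above the diagonal both before and after. *)
Lemma card_unipotent_conj w c (t := toGL (monomial w c) : {'GL_n[F]}) :
  (forall i, c i != 0) -> #|(N :&: N :^ t^-1)%g| = (#|F| ^ #|noninversion w|)%N.
Proof.
move=> c0; have ut := monomial_unitmx w c0.
rewrite -(card_prescribed_mx (noninversion w) 1%:M).
rewrite -(card_imset _ (ofGL_inj n_gt0)); apply: eq_card => A.
rewrite inE; apply/imsetP/forallP => [[u] | AP].
  rewrite inE => /andP[/upper_unipotentP uu].
  rewrite mem_conjg invgK => /upper_unipotentP uv -> [i j].
  rewrite /noninversion /= -implyNb negb_and -!leqNgt.
  apply/implyP => /orP[leji|lewji]; first by rewrite uu // mxE.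
  set v := (u ^ t)%g in uv; have def_u : ofGL u *m monomial w c
      = monomial w c *m ofGL v.
    by rewrite -[monomial w c](toGLK n_gt0) // -!ofGLM // /v conjgE mulKVg.
  move/matrixP/(_ i (w j)): def_u; rewrite monomial_mulr monomial_mull.
  rewrite (uv _ _ lewji) (inj_eq perm_inj) mxE => /eqP.
  have [-> /eqP|_] := eqVneq i j; first by rewrite mulr1 -[RHS]mul1r => /(mulIf (c0 j)) ->.
  by rewrite mulr0 mulf_eq0 (negPf (c0 j)) orbF.
have uA : unitriangular A.
  move=> i j leji; have := AP (i, j).
  by rewrite /noninversion /= ltnNge leji /= mxE => /eqP.
have UA := unitriangular_unitmx uA.
exists (toGL A); last by rewrite toGLK.
rewrite inE; apply/andP; split; first by apply/upper_unipotentP; rewrite toGLK.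
rewrite mem_conjg invgK; apply/upper_unipotentP => i j leji.
rewrite conjgE -toGLV // -!toGLM ?unitmx_mul ?unitmx_inv ?UA ?ut //.
rewrite toGLK ?unitmx_mul ?unitmx_inv ?UA ?ut //.
pose v : 'M[F]_n := \matrix_(i, j) ((c (w^-1%g i))^-1 * c (w^-1%g j) * A (w^-1%g i) (w^-1%g j)).
have -> : A *m monomial w c = monomial w c *m v.
  apply/matrixP => k l; rewrite monomial_mull -[l](permKV w) monomial_mulr !mxE !permK.
  by rewrite !mulrA divff // mul1r mulrC.
rewrite mulKmx // mxE; have := AP (w^-1%g i, w^-1%g j).
rewrite /noninversion /= !permKV [X in _ && X]ltnNge leji andbF /= mxE => /eqP ->.
rewrite (inj_eq perm_inj); case: eqP => [->|_]; last by rewrite mulr0.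
by rewrite mulVf ?mulr1.
Qed.

Lemma card_double_coset w c (t := toGL (monomial w c) : {'GL_n[F]}) :
  (forall i, c i != 0) ->
  (#|N :* t * N|%g * #|F| ^ #|noninversion w| = #|N| ^ 2)%N.
Proof.
by move=> c0; rewrite -(card_unipotent_conj w c0); apply: (card_double_rcoset N t).
Qed.

Lemma card_unipotent : #|N| = (#|F| ^ #|noninversion (1%g : 'S_n)|)%N.
Proof.
rewrite -(@card_unipotent_conj 1 (fun=> 1)) => [|i]; last exact: oner_neq0.
apply/esym/(setI_conj_id (H := N))/upper_unipotentP.
rewrite toGLK ?monomial_unitmx // => [i j _|i]; last exact: oner_neq0.
by rewrite !mxE perm1 eq_sym.
Qed.

End DoubleCoset.

(** * Whittaker functions on the Shalika subgroup *)

Section Additive.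
Variables (C : numClosedFieldType) (F : finFieldType) (psi : F -> C).
Hypothesis hpsi : nontrivial_additive_character psi.

Lemma psi0 : psi 0 = 1. Proof. by case: hpsi. Qed.

Lemma psiD x y : psi (x + y) = psi x * psi y. Proof. by case: hpsi. Qed.

Lemma psi_neq0 x : psi x != 0.
Proof.
apply/eqP => px0; have := psiD x (- x).
by rewrite subrr psi0 px0 mul0r => /eqP; rewrite oner_eq0.
Qed.

Lemma psiN x : psi (- x) = (psi x)^-1.
Proof.
apply: (mulfI (psi_neq0 x)); rewrite -psiD subrr psi0.
by rewrite divff ?psi_neq0.
Qed.

Lemma psi_separates x : x != 0 -> exists a, psi (a * x) != 1.
Proof. by move=> x0; case: hpsi => _ _ [y py]; exists (y / x); rewrite divfK. Qed.

End Additive.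

Definition superdiag (F : finFieldType) n (A : 'M[F]_n) : F :=
  \sum_(i < n) \sum_(j < n | val j == i.+1) A i j.

Lemma superdiag0 (F : finFieldType) n : superdiag (0 : 'M[F]_n) = 0.
Proof. by rewrite /superdiag big1 // => i _; rewrite big1 // => j _; rewrite mxE. Qed.

Lemma superdiag_delta (F : finFieldType) n (a : F) (i j : 'I_n) :
  superdiag (a *: delta_mx i j) = a *+ (val j == i.+1).
Proof.
rewrite /superdiag (bigD1 i) //= [X in _ + X]big1 => [|k /negPf nk]; last first.
  by rewrite big1 // => l _; rewrite !mxE nk mulr0.
rewrite addr0; under eq_bigr do rewrite !mxE eqxx /=.
case: eqP => [ji|nji]; last first.
  rewrite big1 // => l /eqP li; case: eqP => [lj|_]; rewrite ?mulr0 //.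
  by case: nji; rewrite -lj.
rewrite (bigD1 j) ?ji //= eqxx mulr1 big1 ?addr0 // => l /andP[_ /negPf->].
by rewrite mulr0.
Qed.

Section Shuffle.
Variables (C : numClosedFieldType) (F : finFieldType) (psi : F -> C) (m : nat).

(** The image of the upper unitriangular group of size 2m under conjugation by
    the inverse of the shuffle sigma, which lists the odd positions before the
    even ones.  The superdiagonal of the large matrix visits in turn the diagonal
    of the upper right block and the superdiagonal of the lower left block, hence
    the formula for the character. *)
Definition shuffled_unipotent (U : 'M[F]_(m + m)) :=
  [/\ unitriangular (ulsubmx U), upper (ursubmx U),
      strictly_upper (dlsubmx U) & unitriangular (drsubmx U)].

Definition shuffled_char (U : 'M[F]_(m + m)) : C :=
  psi (\tr (ursubmx U) + superdiag (dlsubmx U)).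

Definition shuffled_whittaker (f : 'M[F]_(m + m) -> C) :=
  forall U h V, shuffled_unipotent U -> h \in unitmx -> shuffled_unipotent V ->
  f (U *m h *m V) = shuffled_char U * shuffled_char V * f h.

(** The product of (1 X; 0 1) and diag(p, p). *)
Definition shalika_mx (p X : 'M[F]_m) : 'M[F]_(m + m) := block_mx p (X *m p) 0 p.

End Shuffle.

Section ShalikaSum.
Variables (C : numClosedFieldType) (F : finFieldType) (psi : F -> C) (m : nat).
Hypothesis hpsi : nontrivial_additive_character psi.
Variable f : 'M[F]_(m + m) -> C.
Hypothesis fW : shuffled_whittaker psi f.
Implicit Types p q X Y T u v A D : 'M[F]_m.

Lemma shuffled_block A (B' C' : 'M[F]_m) D : unitriangular A -> upper B' -> strictly_upper C' ->
  unitriangular D -> shuffled_unipotent (block_mx A B' C' D).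
Proof.
by split; rewrite ?block_mxKul ?block_mxKur ?block_mxKdl ?block_mxKdr.
Qed.

Lemma shuffled_char_block A (B' C' : 'M[F]_m) D :
  shuffled_char psi (block_mx A B' C' D) = psi (\tr B' + superdiag C').
Proof. by rewrite /shuffled_char block_mxKur block_mxKdl. Qed.

Lemma shuffled1 : shuffled_unipotent (1%:M : 'M[F]_(m + m)).
Proof.
rewrite [1%:M]scalar_mx_block; apply: shuffled_block; first exact: unitriangular1.
- exact: upper0.
- exact: strictly_upper0.
- exact: unitriangular1.
Qed.

Lemma shuffled_char1 : shuffled_char psi (1%:M : 'M[F]_(m + m)) = 1.
Proof.
by rewrite [1%:M]scalar_mx_block shuffled_char_block mxtrace0 superdiag0 addr0 psi0.
Qed.

Lemma whittaker_mull U h : shuffled_unipotent U -> h \in unitmx ->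
  f (U *m h) = shuffled_char psi U * f h.
Proof.
move=> uU uh; rewrite -[U *m h]mulmx1 fW //; last exact: shuffled1.
by rewrite shuffled_char1 mulr1.
Qed.

Lemma whittaker_mulr h V : h \in unitmx -> shuffled_unipotent V ->
  f (h *m V) = shuffled_char psi V * f h.
Proof.
move=> uh uV; rewrite -[h]mul1mx fW ?mul1mx //; last exact: shuffled1.
by rewrite shuffled_char1 mul1r.
Qed.

(** The value at U h = h V can be computed from either side. *)
Lemma whittaker_vanish U h V :
  shuffled_unipotent U -> h \in unitmx -> shuffled_unipotent V ->
  U *m h = h *m V -> shuffled_char psi U != shuffled_char psi V -> f h = 0.
Proof.
move=> uU uh uV eqh ne; apply/eqP; apply: contraNT ne => fh0.
by apply/eqP/(mulIf fh0); rewrite -whittaker_mull // eqh whittaker_mulr.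
Qed.

Lemma shalika_unitmx p X : p \in unitmx -> shalika_mx p X \in unitmx.
Proof. by move=> up; rewrite unitmxE det_ublock unitrM -unitmxE up. Qed.

Lemma shalikaM p q X Y : p \in unitmx ->
  shalika_mx p X *m shalika_mx q Y = shalika_mx (p *m q) (X + p *m Y *m invmx p).
Proof.
move=> up; rewrite /shalika_mx mulmx_block !mulmx0 !mul0mx !addr0 add0r.
by rewrite mulmxDl -!mulmxA mulKmx // addrC.
Qed.

Lemma shuffled_shalika u T : unitriangular u -> upper T ->
  shuffled_unipotent (shalika_mx u T).
Proof.
move=> uu uT; apply: shuffled_block => //; last exact: strictly_upper0.
by apply: upperM => //; apply: unitriangular_upper.
Qed.

Lemma shuffled_char_shalika1 T : shuffled_char psi (shalika_mx 1%:M T) = psi (\tr T).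
Proof. by rewrite shuffled_char_block superdiag0 addr0 mulmx1. Qed.

Lemma shuffled_char_shalika0 u : shuffled_char psi (shalika_mx u 0) = 1.
Proof.
by rewrite shuffled_char_block superdiag0 addr0 mul0mx mxtrace0 (psi0 hpsi).
Qed.

Definition shalika_term p X := f (shalika_mx p X) * psi (- \tr X).

Definition shalika_sum p := \sum_X shalika_term p X.

Lemma shalika_term_upper p T X : p \in unitmx -> upper T ->
  shalika_term p (T + X) = shalika_term p X.
Proof.
move=> up uT; rewrite /shalika_term.
have -> : shalika_mx p (T + X) = shalika_mx 1%:M T *m shalika_mx p X.
  by rewrite shalikaM ?unitmx1 // !mul1mx invmx1 mulmx1.
rewrite whittaker_mull ?shalika_unitmx //; last first.
  by apply: shuffled_shalika => //; apply: unitriangular1.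
rewrite shuffled_char_shalika1 linearD /= opprD psiD // mulrACA.
by rewrite -psiD // subrr psi0 // mul1r.
Qed.

Lemma shalika_sum_mull u p : unitriangular u -> p \in unitmx ->
  shalika_sum (u *m p) = shalika_sum p.
Proof.
move=> uu up; have Uu := unitriangular_unitmx uu.
pose g X := u *m X *m invmx u.
have gI : injective g.
  apply: (can_inj (g := fun X => invmx u *m X *m u)) => X.
  by rewrite /g !mulmxA mulVmx // mul1mx mulmxKV.
rewrite /shalika_sum (reindex_inj gI); apply: eq_bigr => X _.
rewrite /shalika_term mxtrace_mulC mulKmx //; congr (_ * _).
rewrite -[g X]add0r -shalikaM // whittaker_mull ?shalika_unitmx //.
  by rewrite shuffled_char_shalika0 mul1r.
by apply: shuffled_shalika => //; apply: upper0.
Qed.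

Lemma shalika_sum_mulr p v : p \in unitmx -> unitriangular v ->
  shalika_sum (p *m v) = shalika_sum p.
Proof.
move=> up uv; apply: eq_bigr => X _; congr (_ * _).
have -> : shalika_mx (p *m v) X = shalika_mx p X *m shalika_mx v 0.
  by rewrite shalikaM // mulmx0 mul0mx addr0.
rewrite whittaker_mulr ?shalika_unitmx ?shuffled_char_shalika0 ?mul1r //.
by apply: shuffled_shalika => //; apply: upper0.
Qed.

End ShalikaSum.

(** * Values at the inverse of a monomial matrix *)

Section MonomialValue.
Variables (C : numClosedFieldType) (F : finFieldType) (psi : F -> C) (m : nat).
Hypothesis hpsi : nontrivial_additive_character psi.
Variable f : 'M[F]_(m + m) -> C.
Hypothesis fW : shuffled_whittaker psi f.
Variables (w : 'S_m) (c : 'I_m -> F).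
Hypothesis c_neq0 : forall i, c i != 0.
Implicit Types X Y A T : 'M[F]_m.

Let t := monomial w c.
Let p := invmx t.
Let ut : t \in unitmx := monomial_unitmx w c_neq0.
Let up : p \in unitmx. Proof. by rewrite unitmx_inv. Qed.

Definition monomial_twist A : 'M[F]_m := \matrix_(i, j) (c i / c j * A (w i) (w j)).

Lemma monomial_twistE A : A *m p = p *m monomial_twist A.
Proof.
apply: (can_inj (mulKmx ut)); rewrite mulmxA monomial_conj // mulmxK //.
by rewrite mulmxA mulmxV // mul1mx.
Qed.

Lemma mxtrace_twist A : \tr (monomial_twist A) = \tr A.
Proof.
rewrite /mxtrace [RHS](reindex_inj (@perm_inj _ w)).
by apply: eq_bigr => i _; rewrite mxE divff // mul1r.
Qed.

Lemma monomial_twist_delta a i j :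
  monomial_twist (a *: delta_mx (w i) (w j)) = (a * (c i / c j)) *: delta_mx i j.
Proof.
apply/matrixP => k l; rewrite !mxE !(inj_eq perm_inj).
case: eqP => [->|]; case: eqP => [->|]; rewrite ?mulr0 //= !mulr1.
by rewrite mulrC.
Qed.

Lemma strictly_upper_delta a (i j : 'I_m) : (i < j)%N ->
  strictly_upper (a *: delta_mx i j : 'M[F]_m).
Proof.
move=> ltij k l lelk; rewrite !mxE; case: eqP => [ki|]; case: eqP => [lj|];
  rewrite ?mulr0 //.
by move: lelk; rewrite ki lj leqNgt ltij.
Qed.

(** Keeping the diagonal makes the whole trace of [X] appear on the left-hand
    side of the relations below, as the remainder has trace zero. *)
Definition upper_part X : 'M[F]_m := \matrix_(i, j) (X i j *+ (i <= j)%N).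

Lemma upper_part_upper X : upper (upper_part X).
Proof. by move=> i j ltji; rewrite mxE leqNgt ltji. Qed.

Lemma mxtrace_upper_part X : \tr (upper_part X) = \tr X.
Proof. by apply: eq_bigr => i _; rewrite mxE leqnn. Qed.

(** The entry of [X] at (w j, w i) with i < j is below the diagonal both before
    and after the twist only when w i < w j. *)
Lemma lower_twist_upper X :
    (forall i j : 'I_m, (i < j)%N -> (w i < w j)%N -> X (w j) (w i) = 0) ->
  upper (monomial_twist (X - upper_part X)).
Proof.
move=> X0 j i ltij; rewrite !mxE; have [_|ltw] := leqP (w j) (w i).
  by rewrite subrr mulr0.
by rewrite X0 // mul0rn subr0 mulr0.
Qed.

(** The part of [X] on and above the diagonal is absorbed by a unipotent matrix
    on the left, and the rest by one on the right. *)
Lemma shalika_value X :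
    (forall i j : 'I_m, (i < j)%N -> (w i < w j)%N -> X (w j) (w i) = 0) ->
  f (shalika_mx p X) = psi (\tr X) * f (shalika_mx p 0).
Proof.
move=> X0; set T1 := upper_part X; set T2 := monomial_twist (X - T1).
have -> : shalika_mx p X = shalika_mx 1%:M T1 *m shalika_mx p 0 *m shalika_mx 1%:M T2.
  rewrite !shalikaM ?unitmx1 ?mul1mx ?mulmx1 // mul0mx addr0.
  by rewrite -monomial_twistE mulmxK // addrC subrK.
have u1 := @unitriangular1 F m.
rewrite fW ?shalika_unitmx //; last first.
- by apply: shuffled_shalika => //; apply: lower_twist_upper.
- by apply: shuffled_shalika => //; apply: upper_part_upper.
rewrite !shuffled_char_shalika1 mxtrace_twist linearB /= mxtrace_upper_part subrr.
by rewrite psi0 // mulr1.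
Qed.

(** Take [D] with the single entry [a] at (w i, w j), which is above the diagonal
    both before and after the twist.  Then diag(1, 1 + D), corrected in the upper
    right block by the upper part of [X *m D], moves across the Shalika matrix.
    The product [X *m D] is column w i of [X] put into column w j; the choice of
    j leaves no entry of it that neither side could absorb.  The correction has
    trace a X_(w j, w i), and the character sees nothing else. *)
Lemma shalika_vanish_last X (i j : 'I_m) :
    (i < j)%N -> (w i < w j)%N -> X (w j) (w i) != 0 ->
    (forall l : 'I_m, (j < l)%N -> (w j < w l)%N -> X (w l) (w i) = 0) ->
  f (shalika_mx p X) = 0.
Proof.
move=> ltij ltw Xij maxij.
have [a psia] := psi_separates hpsi Xij.
pose D : 'M[F]_m := a *: delta_mx (w i) (w j).
pose B := upper_part (X *m D).
have XD k l : (X *m D) k l = a * X k (w i) *+ (l == w j).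
  rewrite mxE (bigD1 (w i)) //= big1 => [|s /negPf ns]; last first.
    by rewrite !mxE ns /= mulr0 mulr0.
  rewrite addr0 !mxE eqxx /=; case: eqP => _; rewrite ?mulr0 // mulr1 mulrC //.
pose R := B - X *m D.
have RE k l : R k l = if (k <= l)%N then 0 else - (a * X k (w i) *+ (l == w j)).
  rewrite mxE [B k l]mxE [in X in _ + X]mxE XD.
  by case: leqP => _; rewrite ?mulr1n ?subrr ?sub0r.
pose U : 'M[F]_(m + m) := block_mx 1%:M B 0 (1%:M + D).
pose V : 'M[F]_(m + m) := block_mx 1%:M (monomial_twist R) 0 (1%:M + monomial_twist D).
have u1 := @unitriangular1 F m; have s0 := @strictly_upper0 F m.
apply: (@whittaker_vanish _ _ _ _ hpsi _ fW U _ V); rewrite ?shalika_unitmx //.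
- apply: shuffled_block => //; first exact: upper_part_upper.
  by apply/unitriangularDr/strictly_upper_delta.
- apply: shuffled_block => //; last first.
    by rewrite monomial_twist_delta; apply/unitriangularDr/strictly_upper_delta.
  move=> l k ltkl; rewrite mxE RE; have [_|ltkw] := leqP (w l) (w k).
    by rewrite mulr0.
  rewrite (inj_eq perm_inj).
  case: eqP => [kj|_]; last by rewrite mulr0n oppr0 mulr0.
  by rewrite maxij -?kj // mulr0 mul0rn oppr0 mulr0.
- rewrite !mulmx_block !mul0mx !mulmx0 !mul1mx !mulmx1 !addr0 !add0r.
  rewrite mulmxDl mul1mx !mulmxDr !mulmx1 -mulmxA -!monomial_twistE.
  congr (block_mx _ _ _ _).
  by rewrite mulmxA addrCA -!mulmxDl /R subrK.
rewrite !shuffled_char_block !superdiag0 !addr0 mxtrace_twist [\tr R]linearB /=.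
rewrite mxtrace_upper_part subrr psi0 //.
suff -> : \tr (X *m D) = a * X (w j) (w i) by [].
rewrite /mxtrace (bigD1 (w j)) //= XD eqxx big1 ?addr0 // => l /negPf nl.
by rewrite XD nl mulr0n.
Qed.

(** Among the offending positions, one with w j maximal satisfies the last
    hypothesis of [shalika_vanish_last]. *)
Lemma shalika_vanish X (i j : 'I_m) :
  (i < j)%N -> (w i < w j)%N -> X (w j) (w i) != 0 -> f (shalika_mx p X) = 0.
Proof.
pose bad (q : 'I_m * 'I_m) :=
  [&& (q.1 < q.2)%N, (w q.1 < w q.2)%N & X (w q.2) (w q.1) != 0].
move=> ltij ltw Xij.
have badij : bad (i, j) by rewrite /bad /= ltij ltw.
case: (@arg_maxnP _ _ bad (fun q => w q.2) badij) => -[k l] /and3P[/= ltkl ltwkl Xkl].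
move=> maxkl; apply: (shalika_vanish_last ltkl ltwkl Xkl) => s ltls ltwls.
apply/eqP; apply: contraTT (ltwls) => nz; rewrite -leqNgt.
by apply: (maxkl (k, s)); rewrite /bad /= nz (ltn_trans ltkl) // (ltn_trans ltwkl).
Qed.

(** By [shalika_value] the character cancels in each nonzero summand, so the sum
    only counts the matrices that vanish at the #|noninversion w| positions. *)
Lemma shalika_sum_monomial :
  shalika_sum psi f p * #|F|%:R ^+ #|noninversion w|
  = #|F|%:R ^+ (m * m) * f (shalika_mx p 0).
Proof.
pose P (q : 'I_m * 'I_m) := ~~ noninversion w (w^-1%g q.2, w^-1%g q.1).
have cardP : (#|P| + #|noninversion w| = m * m)%N.
  have -> : (m * m)%N = #|{: 'I_m * 'I_m}| by rewrite card_prod card_ord.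
  have -> : #|noninversion w| = #|[predC P]|; last exact: cardC.
  rewrite -(card_image (f := fun q => (w q.2, w q.1))) => [|[i j] [k l] [/perm_inj-> /perm_inj->] //].
  apply: eq_card => -[i j]; rewrite !inE /P negbK.
  apply/imageP/idP => [[[k l] /= Pkl [-> ->]]|Pij]; first by rewrite !permK.
  by exists (w^-1%g j, w^-1%g i); rewrite //= !permKV.
pose S := [set X : 'M[F]_m | [forall q, P q || (X q.1 q.2 == (0 : 'M[F]_m) q.1 q.2)]].
have -> : shalika_sum psi f p = #|S|%:R * f (shalika_mx p 0).
  rewrite mulr_natl -sumr_const [RHS]big_mkcond /=; apply: eq_bigr => X _.
  rewrite inE; case: forallP => [X0|].
    rewrite /shalika_term shalika_value => [|i j ltij ltw]; last first.
      have := X0 (w j, w i); rewrite /P /noninversion /= !permK ltij ltw /= mxE.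
      by move/eqP.
    by rewrite mulrAC psiN // divff ?mul1r ?(psi_neq0 hpsi).
  move/forallP; rewrite negb_forall => /existsP[[k l]].
  rewrite negb_or /P negbK /noninversion /= mxE => /andP[/andP[ltij ltw] Xkl].
  by rewrite /shalika_term (shalika_vanish ltij ltw) ?mul0r // !permKV.
by rewrite card_prescribed_mx mulrAC -natrX -natrM -expnD cardP natrX.
Qed.

(** A lower left block with one entry [a] at (w i, w j) becomes one with entry
    a c_i / c_j at (i, j).  The second is seen by the character, as j = i + 1,
    and the first only if w j = w i + 1; both values agree for all [a]. *)
Lemma shalika_support (i j : 'I_m) : val j = i.+1 -> (w i < w j)%N ->
  f (shalika_mx p 0) != 0 -> val (w j) = (w i).+1 /\ c i = c j.
Proof.
move=> def_j ltw fp0; pose d := (val (w j) == (w i).+1)%:R - c i / c j.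
have ltij : (i < j)%N by rewrite def_j.
have d0 : d = 0.
  apply/eqP; apply: contraNT fp0 => /(psi_separates hpsi)[a psia].
  pose D : 'M[F]_m := a *: delta_mx (w i) (w j).
  have u1 := @unitriangular1 F m; have u0 := @upper0 F m.
  apply/eqP; apply: (@whittaker_vanish _ _ _ _ hpsi _ fW
    (block_mx 1%:M 0 D 1%:M) _ (block_mx 1%:M 0 (monomial_twist D) 1%:M)).
  - by apply: shuffled_block => //; apply: strictly_upper_delta.
  - exact: shalika_unitmx.
  - by apply: shuffled_block => //; rewrite monomial_twist_delta; apply: strictly_upper_delta.
  - rewrite /shalika_mx mul0mx !mulmx_block !mul0mx !mulmx0 !mul1mx !mulmx1 !addr0 !add0r.
    by rewrite monomial_twistE.
  rewrite !shuffled_char_block mxtrace0 !add0r monomial_twist_delta !superdiag_delta.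
  rewrite def_j eqxx mulr1n; apply: contraNneq psia => eqpsi.
  rewrite /d mulrBr psiD // psiN // mulr_natr eqpsi.
  by rewrite divff ?(psi_neq0 hpsi).
have cij0 : c i / c j != 0 by rewrite mulf_neq0 ?invr_eq0.
move/eqP: d0; rewrite subr_eq0 /d; case: (val (w j) =P _) => [-> /eqP cij | _].
  by split=> //; rewrite -[LHS](divfK (c_neq0 j)) -cij mul1r.
by rewrite eq_sym (negPf cij0).
Qed.

End MonomialValue.

(** * Block antidiagonal matrices with scalar blocks *)

Section Blocks.
Variable F : finFieldType.
Implicit Types s : seq (nat * F).

Definition total_size s := sumn (unzip1 s).

(** [block_pos s i] and [block_coef s i] are the column and the value of the
    nonzero entry in row i of the block antidiagonal matrix of [s]; working with
    functions on nat avoids casts between the sizes. *)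
Fixpoint block_pos s (i : nat) : nat :=
  if s is (k, _) :: s' then
    if (i < k)%N then (i + total_size s')%N else block_pos s' (i - k)
  else 0%N.

Fixpoint block_coef s (i : nat) : F :=
  if s is (k, c) :: s' then if (i < k)%N then c else block_coef s' (i - k)
  else 0.

Definition scalar_blocks s : seq {n : nat & 'M[F]_n} :=
  [seq Tagged (fun n => 'M[F]_n) (x.2%:M : 'M[F]_(x.1)) | x <- s].

Lemma total_size_cons k c s : total_size ((k, c) :: s) = (k + total_size s)%N.
Proof. by []. Qed.

Lemma block_pos_lt s i : (i < total_size s)%N -> (block_pos s i < total_size s)%N.
Proof.
elim: s i => //= -[k c] s IHs i; rewrite total_size_cons => lti.
case: ifP => [ltik|/negbT]; first by rewrite ltn_add2r.
by rewrite -leqNgt => leki; rewrite ltn_addl // IHs // ltn_subLR.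
Qed.

Lemma block_pos_inj s i j : (i < total_size s)%N -> (j < total_size s)%N ->
  block_pos s i = block_pos s j -> i = j.
Proof.
elim: s i j => //= -[k c] s IHs i j; rewrite total_size_cons => lti ltj.
have lt_pos l : (k <= l)%N -> (l < k + total_size s)%N ->
    (block_pos s (l - k) < total_size s)%N.
  by move=> lekl ltl; rewrite block_pos_lt // ltn_subLR.
case: ltnP => [ltik|leki]; case: ltnP => [ltjk|lekj].
- by move/addIn.
- by move=> def_p; have := lt_pos j lekj ltj; rewrite -def_p ltnNge leq_addl.
- by move=> def_p; have := lt_pos i leki lti; rewrite def_p ltnNge leq_addl.
move/IHs; rewrite !ltn_subLR // => /(_ lti ltj) eqij.
by rewrite -(subnK leki) eqij subnK.
Qed.

Lemma block_coef_neq0 s i : all (fun x => x.2 != 0) s ->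
  (i < total_size s)%N -> block_coef s i != 0.
Proof.
elim: s i => //= -[k c] s IHs i /andP[/= c0 s0]; rewrite total_size_cons => lti.
by case: ltnP => // leki; rewrite IHs // ltn_subLR.
Qed.

Lemma all_coef_neq0 s : all (fun x => 0 < x.1)%N s ->
    (forall i, (i < total_size s)%N -> block_coef s i != 0) ->
  all (fun x => x.2 != 0) s.
Proof.
elim: s => //= -[k c] s IHs /andP[/= k0 s0] c0; rewrite total_size_cons in c0.
have := c0 0%N; rewrite addn_gt0 k0 => -> //=; apply: IHs => // i lti.
by have := c0 (k + i)%N; rewrite ltn_add2l lti ltnNge leq_addr /= addKn => ->.
Qed.

Lemma antidiag_scalar_blocks s i j :
  antidiag (scalar_blocks s) i j = block_coef s i *+ (val j == block_pos s i).
Proof.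
elim: s i j => [|[k c] s IHs] i j; first by case: i.
rewrite /= castmxE /=; set i' := cast_ord _ i; set j' := cast_ord _ j.
have -> : val i = val i' by [].
have -> : val j = val j' by [].
have size_s : sumn [seq tag g | g <- scalar_blocks s] = total_size s.
  by rewrite -map_comp.
case: (split_ordP i') => a ->; case: (split_ordP j') => b ->.
- rewrite block_mxEul mxE /= ltn_eqF // (leq_trans (ltn_ord b)) //.
  by rewrite size_s leq_addl.
- by rewrite block_mxEur mxE /= size_s addnC eqn_add2r eq_sym.
- by rewrite block_mxEdl IHs /= addKn.
rewrite block_mxEdr mxE /= addKn gtn_eqF // ltn_addr //.
have lta : (a < total_size s)%N by rewrite -[X in (_ < X)%N]size_s ltn_ord.
by rewrite [X in (_ < X)%N]size_s block_pos_lt.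
Qed.

Lemma even_scalar_blocksE ms la :
  even_scalar_blocks ms la
  = scalar_blocks [seq ((2 * x.1)%N, x.2) | x <- zip ms la] :> seq {n : nat & 'M[F]_n}.
Proof. by rewrite /scalar_blocks -map_comp. Qed.

Lemma total_size_double s :
  total_size [seq ((2 * x.1)%N, x.2) | x <- s] = (2 * total_size s)%N.
Proof. by elim: s => //= x s IHs; rewrite /total_size /= in IHs *; rewrite IHs mulnDr. Qed.

Lemma block_pos_double s i (e : bool) : (i < total_size s)%N ->
  block_pos [seq ((2 * x.1)%N, x.2) | x <- s] (e + i.*2) = (e + (block_pos s i).*2)%N.
Proof.
elim: s i => //= -[k c] s IHs i; rewrite total_size_cons /= => lti.
have -> : (e + i.*2 < 2 * k)%N = (i < k)%N.
  by rewrite mul2n; case: (e); rewrite /= ?add1n ?add0n ?ltn_Sdouble ?ltn_double.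
case: ltnP => [ltik|leki]; first by rewrite total_size_double mul2n doubleD addnA.
by rewrite -IHs ?ltn_subLR // doubleB mul2n addnBA ?leq_double.
Qed.

Lemma block_coef_double s i (e : bool) : (i < total_size s)%N ->
  block_coef [seq ((2 * x.1)%N, x.2) | x <- s] (e + i.*2) = block_coef s i.
Proof.
elim: s i => //= -[k c] s IHs i; rewrite total_size_cons /= => lti.
have -> : (e + i.*2 < 2 * k)%N = (i < k)%N.
  by rewrite mul2n; case: (e); rewrite /= ?add1n ?add0n ?ltn_Sdouble ?ltn_double.
case: ltnP => [//|leki].
by rewrite -IHs ?ltn_subLR // doubleB mul2n addnBA ?leq_double.
Qed.

(** The bottom left corner meets the last block in its diagonal only if that
    block has size one. *)
Lemma block_corner s : (0 < size s)%N -> all (fun x => 0 < x.1)%N s ->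
  block_coef s (total_size s).-1 *+ (0 == block_pos s (total_size s).-1)%N
  = last 0 (unzip2 s) * (last 0%N (unzip1 s) == 1%N)%:R.
Proof.
elim: s => //= -[k c] s IHs _ /andP[/= k0 s0]; rewrite total_size_cons.
case: s IHs s0 => [_ _|x s IHs s0].
  by rewrite addn0 prednK // leqnn /= addn0 eq_sym -eqSS prednK // mulr_natr.
have := IHs isT s0; set xs := x :: s => <-.
have xs0 : (0 < total_size xs)%N by case/andP: s0; rewrite /total_size /= addn_gt0 => ->.
rewrite ltnNge -ltnS prednK ?addn_gt0 ?k0 // -[X in (X < _)%N]addn0 ltn_add2l xs0 /=.
by rewrite -subn1 addnC -addnBAC // addnK subn1.
Qed.

(** Row 0 has its entry in the column where the first block starts, so it gives
    the total size of the other blocks. *)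
Lemma blocks_unique s1 s2 :
    all (fun x => 0 < x.1)%N s1 -> all (fun x => 0 < x.1)%N s2 ->
    total_size s1 = total_size s2 ->
    (forall i, i < total_size s1 -> block_pos s1 i = block_pos s2 i)%N ->
    (forall i, (i < total_size s1)%N -> block_coef s1 i = block_coef s2 i) ->
  s1 = s2.
Proof.
elim: s1 s2 => [|[k1 c1] s1 IHs] [|[k2 c2] s2] //=.
- by move=> _ /andP[/= k0 _] /eqP; rewrite total_size_cons eq_sym addn_eq0 -leqn0 leqNgt k0.
- by move=> /andP[/= k0 _] _ /eqP; rewrite total_size_cons addn_eq0 -leqn0 leqNgt k0.
move=> /andP[/= k10 s10] /andP[/= k20 s20]; rewrite !total_size_cons => eq_n eq_p eq_c.
have n0 : (0 < k1 + total_size s1)%N by rewrite addn_gt0 k10.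
have := eq_p 0%N n0; have := eq_c 0%N n0; rewrite k10 k20 !add0n => eq_c12 eq_s.
have eq_k : k1 = k2 by move: eq_n; rewrite eq_s => /addIn.
rewrite eq_c12 eq_k (IHs s2) // => i lti.
  by have := eq_p (k1 + i)%N; rewrite ltn_add2l -eq_k => /(_ lti); rewrite ltnNge leq_addr /= addKn.
by have := eq_c (k1 + i)%N; rewrite ltn_add2l -eq_k => /(_ lti); rewrite ltnNge leq_addr /= addKn.
Qed.

(** The maximal run of consecutive values at the start of [w] must end at the
    top value: after a descent the values can only climb in steps of one, and
    they cannot cross the values that the first run has used. *)
Lemma blocks_exist n (w : nat -> nat) (c : nat -> F) :
    (forall i, i < n -> w i < n)%N ->
    (forall i j, (i < n)%N -> (j < n)%N -> w i = w j -> i = j) ->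
    (forall i, (i.+1 < n)%N -> (w i < w i.+1)%N -> w i.+1 = (w i).+1 /\ c i = c i.+1) ->
  exists s, [/\ all (fun x => 0 < x.1)%N s, total_size s = n &
    forall i, (i < n)%N -> w i = block_pos s i /\ c i = block_coef s i].
Proof.
have [b le_nb] := ubnP n; elim: b => // b IHb in n w c le_nb * => w_lt w_inj w_step.
have [->|n_gt0] := posnP n; first by exists [::].
pose P k := (k <= n)%N && all (fun i => (w i == w 0 + i)%N && (c i == c 0)) (iota 0 k).
have P1 : exists k, P k by exists 1%N; rewrite /P n_gt0 /= addn0 !eqxx.
have Pn k : P k -> (k <= n)%N by case/andP.
case: (ex_maxnP P1 Pn) => k /andP[le_kn /allP run] maxk.
have k_gt0 : (0 < k)%N by apply: maxk; rewrite /P n_gt0 /= addn0 !eqxx.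
have run_w i : (i < k)%N -> w i = (w 0 + i)%N.
  by move=> ltik; have /andP[/eqP] := run i (etrans (mem_iota 0 k i) ltik).
have run_c i : (i < k)%N -> c i = c 0%N.
  by move=> ltik; have /andP[_ /eqP] := run i (etrans (mem_iota 0 k i) ltik).
have below i : (k <= i)%N -> (i < n)%N -> (w i < w 0)%N.
  elim: i => [|i IHi]; first by rewrite leqNgt k_gt0.
  move=> le_ki lt_in.
  have ne_w : w i.+1 != w 0 by apply/eqP => /(w_inj _ _ lt_in n_gt0).
  move: le_ki; rewrite leq_eqVlt => /orP[/eqP def_k|lt_ki]; last first.
    have lt_w := IHi lt_ki (ltnW lt_in).
    have [/(w_step _ lt_in)[def_w _]|/leq_ltn_trans-> //] := ltnP (w i) (w i.+1).
    by rewrite ltn_neqAle ne_w def_w.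
  have lt_ik : (i < k)%N by rewrite def_k.
  have [ltw|lew] := ltnP (w i) (w i.+1).
    have [def_w def_c] := w_step _ lt_in ltw.
    have : P k.+1; last by move/maxk; rewrite ltnn.
    rewrite /P {1}def_k lt_in andTb -addn1 iotaD all_cat /= andbT add0n.
    apply/andP; split; first exact/allP.
    by rewrite def_k def_w -def_c run_c // run_w // addnS !eqxx.
  rewrite ltnNge; apply/negP => le_w0.
  have lt_dk : (w i.+1 - w 0 < k)%N.
    by rewrite (leq_ltn_trans (leq_sub2r _ lew)) // run_w // addKn.
  have := w_inj i.+1 (w i.+1 - w 0)%N lt_in (leq_trans lt_dk le_kn).
  by rewrite (run_w _ lt_dk) subnKC // => /(_ erefl) def_i; move: lt_dk; rewrite -def_i -def_k ltnn.
have w0 : w 0%N = (n - k)%N.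
  apply/eqP; rewrite eqn_leq leq_subRL //; apply/andP; split.
    have := w_lt k.-1; rewrite run_w ?prednK // => /(_ le_kn).
    by rewrite -addnS prednK // addnC.
  have w_uniq : uniq [seq w i | i <- iota k (n - k)].
    rewrite map_inj_in_uniq ?iota_uniq // => i j; rewrite !mem_iota subnKC //.
    by move=> /andP[_ lti] /andP[_ ltj]; apply: w_inj.
  have w_sub : {subset [seq w i | i <- iota k (n - k)] <= iota 0 (w 0)}.
    move=> x /mapP[j]; rewrite !mem_iota subnKC // => /andP[leki ltin] ->.
    exact: below.
  by have := uniq_leq_size w_uniq w_sub; rewrite size_map !size_iota.
have [||||s [s_gt0 size_s s_w]] := IHb (n - k)%N (fun i => w (k + i)%N) (fun i => c (k + i)%N).
- by apply: (@leq_trans n); rewrite // -[X in (_ < X)%N]subn0 ltn_sub2l.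
- by move=> i; rewrite ltn_subRL -w0 => lti; rewrite below ?leq_addr.
- by move=> i j; rewrite !ltn_subRL => lti ltj /(w_inj _ _ lti ltj)/addnI.
- by move=> i; rewrite !ltn_subRL addnS; apply: w_step.
exists ((k, c 0%N) :: s); split; first by rewrite /= k_gt0.
  by rewrite total_size_cons size_s subnKC.
move=> i lt_in /=; case: ltnP => [lt_ik|le_ki].
  by rewrite run_w // run_c // w0 size_s addnC.
by have := s_w (i - k)%N; rewrite subnKC // ltn_sub2r ?(leq_ltn_trans le_ki) // => /(_ isT).
Qed.

Definition pair_count n (w : nat -> nat) :=
  (\sum_(0 <= j < n) \sum_(0 <= i < j) (w i < w j))%N.

(** Rows of different blocks are inverted by [block_pos], and rows of the same
    block are not. *)
Lemma pair_count_block s :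
  pair_count (total_size s) (block_pos s) = (\sum_(x <- s) 'C(x.1, 2))%N.
Proof.
elim: s => [|[k c] s IHs]; first by rewrite big_nil /pair_count big_nil.
rewrite big_cons total_size_cons -IHs /pair_count (@big_cat_nat _ _ _ k) ?leq_addr //=.
congr (_ + _)%N.
  rewrite -bin2_sum; apply: eq_big_nat => j /andP[_ ltj]; rewrite ltj.
  rewrite (eq_big_nat _ _ (F2 := fun=> 1%N)) => [|i /andP[_ ltij]].
    by rewrite sum_nat_const_nat subn0 muln1.
  by rewrite (ltn_trans ltij) // ltn_add2r ltij.
rewrite -{1}[k]add0n big_addn addKn; apply: eq_big_nat => j /andP[_ ltj].
rewrite ltnNge leq_addl /= addnK (@big_cat_nat _ _ _ k) ?leq_addl //=.
rewrite big_nat big1 ?add0n => [|i /andP[_ ltik]]; last first.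
  rewrite ltik ltnNge ltnW //.
  by apply: (leq_trans (block_pos_lt ltj)); rewrite leq_addl.
rewrite -{1}[k]add0n big_addn addnK; apply: eq_big_nat => i /andP[_ ltij].
by rewrite [(i + k < k)%N]ltnNge leq_addl /= addnK.
Qed.

End Blocks.

Lemma card_noninversion n (w : 'S_n) (w' : nat -> nat) :
  (forall i : 'I_n, w' i = w i) -> #|noninversion w| = pair_count n w'.
Proof.
move=> eq_w; rewrite -sum1_card /pair_count big_mkord.
transitivity (\sum_(i < n) \sum_(j < n) ((i < j) && (w i < w j))%N)%N.
  rewrite pair_big big_mkcond /=; apply: eq_bigr => -[i j] _.
  by rewrite unfold_in /noninversion /=; case: (_ && _).
rewrite exchange_big; apply: eq_bigr => j _; rewrite big_mkord.
rewrite (big_ord_widen_cond n xpredT (fun i => (w' i < w' j) : nat)) ?(ltnW (ltn_ord j)) //=.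
rewrite [RHS]big_mkcond; apply: eq_bigr => i _; rewrite !eq_w.
by case: (i < j)%N.
Qed.

(** * Double cosets that meet the support *)

Section Compositions.
Variables (C : numClosedFieldType) (F : finFieldType) (m : nat).
Implicit Types s : seq (nat * F).

Definition composition s :=
  [&& all (fun x => 0 < x.1)%N s, all (fun x => x.2 != 0) s & total_size s == m].

Lemma leq_total_size s x : x \in s -> (x.1 <= total_size s)%N.
Proof.
elim: s => //= y s IHs; rewrite /total_size /= inE => /orP[/eqP->|/IHs le_x].
  exact: leq_addr.
by rewrite (leq_trans le_x) // leq_addl.
Qed.

Lemma size_composition s : composition s -> (size s <= m)%N.
Proof.
case/and3P => s0 _ /eqP <-; elim: s s0 => //= x s IHs /andP[x0 /IHs le_s].
by rewrite /total_size /= -add1n leq_add.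
Qed.

Lemma composition_zip r (ms : r.-tuple 'I_m.+1) (la : r.-tuple F) :
    all (fun k : 'I_m.+1 => 0 < k)%N ms && (\sum_(k <- ms) k == m)%N ->
    all (fun x => x != 0) la -> composition (zip (map val ms) la).
Proof.
move=> /andP[ms0 /eqP sum_ms] la0.
have eq_size : size (map val ms) = size la by rewrite size_map !size_tuple.
have z1 : unzip1 (zip (map val ms) la) = map val ms by rewrite unzip1_zip ?eq_size.
have z2 : unzip2 (zip (map val ms) la) = la by rewrite unzip2_zip ?eq_size.
apply/and3P; split.
- by rewrite -(all_map fst (fun k => 0 < k)%N) -/(unzip1 _) z1 all_map.
- by rewrite -(all_map snd (fun x => x != 0)) -/(unzip2 _) z2.
by rewrite /total_size z1 sumnE big_map sum_ms.
Qed.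

(** The triple sum runs over the admissible lists of pairs (m_i, lambda_i), each
    taken once. *)
Lemma sum_compositions (E : seq (nat * F) -> C) s0 : (0 < m)%N ->
    composition s0 -> (forall s, composition s -> s != s0 -> E s = 0) ->
  \sum_(1 <= r < m.+1)
    \sum_(ms : r.-tuple 'I_m.+1
            | all (fun k : 'I_m.+1 => 0 < k)%N ms && (\sum_(k <- ms) k == m)%N)
    \sum_(la : r.-tuple F | all (fun x => x != 0) la) E (zip (map val ms) la)
  = E s0.
Proof.
move=> m_gt0 comp0 E0; have /and3P[s0_gt0 s0_neq0 /eqP size_s0] := comp0.
have sum_s0 : sumn (unzip1 s0) = m := size_s0.
have s0_size : (0 < size s0 <= m)%N.
  rewrite size_composition // andbT lt0n size_eq0.
  by apply: contraTneq m_gt0 => s0_nil; rewrite -size_s0 s0_nil.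
have inord_s0 : map val (map (@inord m) (unzip1 s0)) = unzip1 s0.
  rewrite -map_comp map_id_in // => _ /mapP[x xs ->] /=.
  by rewrite inordK // ltnS -size_s0 leq_total_size.
have size1 : size (map (@inord m) (unzip1 s0)) == size s0 by rewrite !size_map.
have size2 : size (unzip2 s0) == size s0 by rewrite size_map.
pose ms0 := Tuple size1; pose la0 := Tuple size2.
have zip0 : zip (map val ms0) la0 = s0 by rewrite /= inord_s0 zip_unzip.
rewrite (bigD1_seq (size s0)) ?iota_uniq ?mem_index_iota ?ltnS //=.
rewrite [X in _ + X]big1_seq ?addr0 => [|r /andP[ne_r _]]; last first.
  rewrite big1 // => ms ms_ok; rewrite big1 // => la la_ok; rewrite E0 ?composition_zip //.
  apply: contraNneq ne_r => <-.
  by rewrite size_zip size_map !size_tuple minnn.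
rewrite (bigD1 ms0) /=; last first.
  rewrite -(all_map val (fun k => 0 < k)%N) inord_s0 all_map s0_gt0 /=.
  by rewrite -(big_map val xpredT id) inord_s0 -sumnE sum_s0.
rewrite [X in _ + X]big1 ?addr0 => [|ms /andP[ms_ok ne_ms]]; last first.
  rewrite big1 // => la la_ok; rewrite E0 ?composition_zip //.
  apply: contraNneq ne_ms => eq_s; apply/eqP/val_inj/(inj_map val_inj) => /=.
  by rewrite inord_s0; move/(congr1 unzip1): eq_s; rewrite unzip1_zip // size_map !size_tuple.
rewrite (bigD1 la0) /=; last by rewrite all_map.
rewrite [X in _ + X]big1 ?addr0 => [|la /andP[la_ok ne_la]]; last first.
  rewrite E0 ?(@composition_zip _ ms0) //.
    rewrite -(all_map val (fun k => 0 < k)%N) inord_s0 all_map s0_gt0 /=.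
    by rewrite -(big_map val xpredT id) inord_s0 -sumnE sum_s0.
  apply: contraNneq ne_la => eq_s; apply/eqP/val_inj => /=.
  by move/(congr1 unzip2): eq_s; rewrite unzip2_zip // !size_map size_tuple.
by rewrite inord_s0 zip_unzip.
Qed.

End Compositions.

Section Cells.
Variables (C : numClosedFieldType) (F : finFieldType) (psi : F -> C) (m : nat).
Hypothesis hpsi : nontrivial_additive_character psi.
Hypothesis m_gt0 : (0 < m)%N.
Variable f : 'M[F]_(m + m) -> C.
Hypothesis fW : shuffled_whittaker psi f.
Implicit Types (s : seq (nat * F)) (g : {'GL_m[F]}).

Let N := upper_unipotent_group F m_gt0.

Lemma natrq_neq0 k : #|F|%:R ^+ k != 0 :> C.
Proof. by rewrite expf_neq0 // pnatr_eq0 -lt0n (cardD1 0) inE. Qed.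

Definition block_mono s : 'M[F]_m :=
  \matrix_(i, j) (block_coef s i *+ (val j == block_pos s i)).

Lemma block_monoE s : composition m s ->
  exists2 w : 'S_m, forall i : 'I_m, block_pos s i = w i
    & block_mono s = monomial w (block_coef s).
Proof.
case/and3P => _ _ /eqP size_s.
have pos_lt (i : 'I_m) : (block_pos s i < m)%N by rewrite -{2}size_s block_pos_lt // size_s.
pose h i := Ordinal (pos_lt i).
have h_inj : injective h.
  move=> i j /(congr1 val) /= /block_pos_inj eq_ij; apply/val_inj/eq_ij; rewrite size_s //.
exists (perm h_inj) => [i|]; first by rewrite permE.
by apply/matrixP => i j; rewrite !mxE permE.
Qed.

Lemma composition_coef s (i : 'I_m) : composition m s -> block_coef s i != 0.
Proof. by case/and3P => _ s0 /eqP sz; rewrite block_coef_neq0 // sz. Qed.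

Lemma block_mono_unitmx s : composition m s -> block_mono s \in unitmx.
Proof.
move=> cs; have [w _ ->] := block_monoE cs.
by apply: monomial_unitmx => i; apply: composition_coef.
Qed.

Definition cell s : {set {'GL_m[F]}} := (N :* toGL (block_mono s) * N)%g.

Lemma cellP s g : composition m s ->
  reflect (exists2 U, unitriangular U & exists2 V, unitriangular V
             & ofGL g = U *m block_mono s *m V)
          (g \in cell s).
Proof.
move=> cs; have us := block_mono_unitmx cs; apply: (iffP mulsgP).
  case=> _ v /rcosetP[u /upper_unipotentP uu ->] /upper_unipotentP uv ->.
  by exists (ofGL u) => //; exists (ofGL v); rewrite // !ofGLM // toGLK.
case=> U uU [V uV def_g]; have UU := unitriangular_unitmx uU.
have UV := unitriangular_unitmx uV.
exists (toGL U * toGL (block_mono s))%g (toGL V).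
- by apply/rcosetP; exists (toGL U) => //; apply/upper_unipotentP; rewrite toGLK.
- by apply/upper_unipotentP; rewrite toGLK.
by rewrite -!toGLM ?unitmx_mul ?UU // -def_g ofGLK.
Qed.

Lemma cell_unique s1 s2 g : composition m s1 -> composition m s2 ->
  g \in cell s1 -> g \in cell s2 -> s1 = s2.
Proof.
move=> cs1 cs2 /(cellP _ cs1)[U1 uU1 [V1 uV1 def1]] /(cellP _ cs2)[U2 uU2 [V2 uV2 def2]].
have [w1 eq_w1 eq_m1] := block_monoE cs1; have [w2 eq_w2 eq_m2] := block_monoE cs2.
have UU2 := unitriangular_unitmx uU2; have UV1 := unitriangular_unitmx uV1.
have := @Bruhat_unique _ _ w1 w2 (block_coef s1) (block_coef s2) (invmx U2 *m U1)
  (V2 *m invmx V1).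
case=> [||i||eq_w eq_c].
- by apply: unitriangularM => //; apply: unitriangular_inv.
- by apply: unitriangularM => //; apply: unitriangular_inv.
- exact: composition_coef.
- rewrite -eq_m1 -eq_m2; apply: (can_inj (mulKmx UU2)); apply: (can_inj (mulmxK UV1)).
  by rewrite !mulmxA mulmxV // mul1mx -def1 def2 mulmxKV.
have /and3P[p1 _ /eqP z1] := cs1; have /and3P[p2 _ /eqP z2] := cs2.
apply: blocks_unique; rewrite ?z1 ?z2 // => i lti.
  by rewrite (eq_w1 (Ordinal lti)) (eq_w2 (Ordinal lti)) eq_w.
exact: (eq_c (Ordinal lti)).
Qed.

Lemma shalika_sum_coset U V A : unitriangular U -> unitriangular V -> A \in unitmx ->
  shalika_sum psi f (invmx (U *m A *m V)) = shalika_sum psi f (invmx A).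
Proof.
move=> uU uV uA; have UU := unitriangular_unitmx uU; have UV := unitriangular_unitmx uV.
rewrite !invmx_mul ?unitmx_mul ?UU ?uA //.
rewrite (shalika_sum_mull hpsi fW) ?unitmx_mul ?unitmx_inv ?UU ?uA //.
  by rewrite (shalika_sum_mulr hpsi fW) ?unitmx_inv //; apply: unitriangular_inv.
exact: unitriangular_inv.
Qed.

(** The Bruhat decomposition reduces to a monomial matrix; [shalika_support] makes
    its permutation and coefficients those of a block antidiagonal matrix. *)
Lemma cell_exists g : shalika_sum psi f (invmx (ofGL g)) != 0 ->
  exists2 s, composition m s & g \in cell s.
Proof.
have [w [c [U [V [uU uV c0 def_g]]]]] := Bruhat_exists (ofGL_unit m_gt0 g).
have ut := monomial_unitmx w c0.
rewrite def_g shalika_sum_coset // => sum0.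
have f0 : f (shalika_mx (invmx (monomial w c)) 0) != 0.
  apply: contraNneq sum0 => f0; have := shalika_sum_monomial hpsi fW w c0.
  by rewrite f0 mulr0 => /eqP; rewrite mulf_eq0 (negPf (natrq_neq0 _)) orbF.
(* [blocks_exist] speaks of functions on nat; the default values never occur. *)
pose ext T (x0 : T) (h : 'I_m -> T) (i : nat) := oapp h x0 (insub i).
have extE T x0 h (i : 'I_m) : @ext T x0 h i = h i by rewrite /ext valK.
have extO T x0 h i (lti : (i < m)%N) : @ext T x0 h i = h (Ordinal lti).
  exact: (extE T x0 h (Ordinal lti)).
have [|i j lti ltj||s [s_gt0 size_s s_w]] :=
    @blocks_exist F m (ext nat 0%N (fun i => w i : nat)) (ext F 0 c).
- by move=> i lti; rewrite extO.
- by rewrite (extO _ _ _ _ lti) (extO _ _ _ _ ltj) => /val_inj/perm_inj/(congr1 val).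
- move=> i lti1; have lti := ltnW lti1.
  rewrite !(extO _ _ _ _ lti) !(extO _ _ _ _ lti1) => ltw.
  by have [] := shalika_support hpsi fW c0 (i := Ordinal lti) (j := Ordinal lti1) erefl ltw f0.
have s_coef i (lti : (i < m)%N) : block_coef s i = c (Ordinal lti).
  by have [_ <-] := s_w i lti; rewrite extO.
have cs : composition m s.
  apply/and3P; split; rewrite ?size_s //.
  by apply: all_coef_neq0 => // i; rewrite size_s => lti; rewrite (s_coef i lti).
exists s => //; apply/cellP => //; exists U => //; exists V => //.
rewrite def_g; congr (_ *m _ *m _); apply/matrixP => i j; rewrite !mxE.
have [<- <-] := s_w i (ltn_ord i); rewrite !extE.
by rewrite -val_eqE.
Qed.

Lemma card_noninversion_composition s (w : 'S_m) : composition m s ->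
    (forall i : 'I_m, block_pos s i = w i) ->
  #|noninversion w| = (\sum_(x <- s) 'C(x.1, 2))%N.
Proof.
move=> /and3P[_ _ /eqP size_s] eq_w.
by rewrite (card_noninversion eq_w) -pair_count_block size_s.
Qed.

(** For the inverse of a block antidiagonal matrix, [shalika_sum_monomial] with
    the number of noninversions put in. *)
Lemma shalika_sum_cell s : composition m s ->
  shalika_sum psi f (invmx (block_mono s)) * #|F|%:R ^+ (\sum_(x <- s) 'C(x.1, 2))
  = #|F|%:R ^+ (m * m) * f (shalika_mx (invmx (block_mono s)) 0).
Proof.
move=> cs; have [w eq_w ->] := block_monoE cs.
rewrite -(@shalika_sum_monomial _ _ _ _ hpsi _ fW w) => [|i]; last exact: composition_coef.
by rewrite (card_noninversion_composition cs eq_w).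
Qed.

Lemma card_cell s : composition m s ->
  (#|cell s| * #|F| ^ (\sum_(x <- s) 'C(x.1, 2)) = #|N| ^ 2)%N.
Proof.
move=> cs; have [w eq_w eq_s] := block_monoE cs.
rewrite -(@card_double_coset _ _ m_gt0 w (block_coef s)) => [|i]; last first.
  exact: composition_coef.
by rewrite /cell eq_s (card_noninversion_composition cs eq_w).
Qed.

Lemma card_unipotent_bin : #|N| = (#|F| ^ 'C(m, 2))%N.
Proof.
rewrite card_unipotent (@card_noninversion _ _ id) => [|i]; last by rewrite perm1.
congr (_ ^ _)%N; rewrite /pair_count -bin2_sum; apply: eq_big_nat => j _.
rewrite (eq_big_nat _ _ (F2 := fun=> 1%N)) => [|i /andP[_ ->] //].
by rewrite sum_nat_const_nat subn0 muln1.
Qed.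

(** Each double coset contributes its cardinality times the value at its
    representative; one factor q^(- nu) comes from the cardinality and one from
    [shalika_sum_cell], whence the factor 2 in the exponent. *)
Lemma shalika_sum_total (phi : 'M[F]_m -> C) :
    (forall U A V, unitriangular U -> unitriangular V -> phi (U *m A *m V) = phi A) ->
  \sum_(g : {'GL_m[F]}) shalika_sum psi f (invmx (ofGL g)) * phi (ofGL g)
  = #|F|%:R ^+ (m * m + 2 * 'C(m, 2))
    * \sum_(1 <= r < m.+1)
        \sum_(ms : r.-tuple 'I_m.+1
           | all (fun k : 'I_m.+1 => 0 < k)%N ms && (\sum_(k <- ms) k == m)%N)
        \sum_(la : r.-tuple F | all (fun x => x != 0) la)
          let s := zip (map val ms) la in
          #|F|%:R ^- (\sum_(x <- s) 2 * 'C(x.1, 2))%N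
          * f (shalika_mx (invmx (block_mono s)) 0) * phi (block_mono s).
Proof.
move=> phi_inv; set K := fun g : {'GL_m[F]} => shalika_sum psi f (invmx (ofGL g)).
pose E s := #|F|%:R ^+ (m * m + 2 * 'C(m, 2)) * (#|F|%:R ^- (\sum_(x <- s) 2 * 'C(x.1, 2))%N
          * f (shalika_mx (invmx (block_mono s)) 0) * phi (block_mono s)).
have E_cell s : composition m s -> E s = \sum_(g in cell s) K g * phi (ofGL g).
  move=> cs; rewrite (eq_bigr (fun=> shalika_sum psi f (invmx (block_mono s)) * phi (block_mono s))); last first.
    move=> g /(cellP _ cs)[U uU [V uV def_g]].
    by rewrite /K def_g shalika_sum_coset ?phi_inv ?block_mono_unitmx.
  rewrite sumr_const -mulr_natl /E -big_distrr /=; set e := (\sum_(x <- s) 'C(x.1, 2))%N.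
  have Ksum : shalika_sum psi f (invmx (block_mono s))
      = #|F|%:R ^+ (m * m) * f (shalika_mx (invmx (block_mono s)) 0) / #|F|%:R ^+ e.
    by apply: (canRL (mulfK (natrq_neq0 e))); apply: shalika_sum_cell.
  have cardc : #|cell s|%:R = #|F|%:R ^+ (2 * 'C(m, 2)) / #|F|%:R ^+ e :> C.
    apply: (canRL (mulfK (natrq_neq0 e))).
    by rewrite -natrX -natrM card_cell // card_unipotent_bin -expnM natrX mulnC.
  rewrite Ksum cardc !mul2n -!addnn !exprD.
  by field; apply: natrq_neq0.
transitivity (\sum_(1 <= r < m.+1)
    \sum_(ms : r.-tuple 'I_m.+1
       | all (fun k : 'I_m.+1 => 0 < k)%N ms && (\sum_(k <- ms) k == m)%N)
    \sum_(la : r.-tuple F | all (fun x => x != 0) la)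
      E (zip (map val ms) la)); last first.
  rewrite mulr_sumr; apply: eq_bigr => r _.
  rewrite mulr_sumr; apply: eq_bigr => ms _.
  by rewrite mulr_sumr.
transitivity (\sum_(g : {'GL_m[F]}) \sum_(1 <= r < m.+1)
    \sum_(ms : r.-tuple 'I_m.+1
       | all (fun k : 'I_m.+1 => 0 < k)%N ms && (\sum_(k <- ms) k == m)%N)
    \sum_(la : r.-tuple F | all (fun x => x != 0) la)
      K g * phi (ofGL g) *+ (g \in cell (zip (map val ms) la))).
  apply: eq_bigr => g _; have [Kg0|/cell_exists[s cs gs]] := eqVneq (K g) 0.
    rewrite -/(K g) Kg0 mul0r big1 // => r _; rewrite big1 // => ms _.
    by rewrite big1 // => la _; rewrite mul0rn.
  rewrite (@sum_compositions _ _ _ (fun s => K g * phi (ofGL g) *+ (g \in cell s)) s) //.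
    by rewrite gs.
  move=> s1 cs1; case gs1 : (g \in cell s1) => //.
  by rewrite (cell_unique cs1 cs gs1 gs) eqxx.
rewrite exchange_big; apply: eq_bigr => r _ /=.
rewrite exchange_big; apply: eq_bigr => ms ms_ok /=.
rewrite exchange_big; apply: eq_bigr => la la_ok /=.
rewrite E_cell ?composition_zip // [RHS]big_mkcond /=.
by apply: eq_bigr => g _; case: (g \in _).
Qed.

End Cells.

(** * Sums over the stabiliser of the last basis covector *)

Section Mirabolic.
Variables (C : numClosedFieldType) (F : finFieldType) (psi : F -> C) (m : nat).
Hypothesis hpsi : nontrivial_additive_character psi.
Hypothesis m_gt0 : (0 < m)%N.
Variable f : 'M[F]_(m + m) -> C.
Hypothesis fW : shuffled_whittaker psi f.
Implicit Types (s : seq (nat * F)) (A : 'M[F]_m).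

Fact last_proof : (m.-1 < m)%N. Proof. by rewrite prednK. Qed.
Definition last_ord : 'I_m := Ordinal last_proof.

Lemma eq_last_ord (j : 'I_m) : (j == last_ord) = (j.+1 == m).
Proof. by rewrite -val_eqE /= -eqSS prednK. Qed.

Lemma epsilon_mulmx k (A : 'M[F]_(m, k)) : epsilon F m *m A = row last_ord A.
Proof.
by rewrite rowE; congr (_ *m _); apply/rowP => j; rewrite !mxE eq_last_ord.
Qed.

Lemma row_last_unitriangular A : unitriangular A -> row last_ord A = epsilon F m.
Proof.
move=> uA; apply/rowP => j; rewrite !mxE uA; first by rewrite eq_sym eq_last_ord.
by rewrite /= -ltnS prednK.
Qed.

Lemma epsilon_unitriangular k A (B : 'M[F]_(m, k)) : unitriangular A ->
  epsilon F m *m (A *m B) = epsilon F m *m B.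
Proof. by move=> uA; rewrite mulmxA epsilon_mulmx row_last_unitriangular. Qed.

(** Row m of the product starts with the entry of the last block, in the last
    column of that block; to be epsilon it must end there with the value 1, so
    that the last block ends in column m, as only a single block does. *)
Lemma composition_fixing_epsilon s A : composition m s -> unitriangular A ->
  epsilon F m *m (block_mono m s *m A) = epsilon F m -> s = [:: (m, 1)].
Proof.
move=> cs uA; rewrite epsilon_mulmx; have [w eq_w ->] := block_monoE cs.
have c0 := composition_coef last_ord cs.
move/rowP/(_ (w last_ord)); rewrite [LHS]mxE [RHS]mxE monomial_mull.
rewrite unitriangular_diag // mulr1 -eq_last_ord.
have [w_last c1|_ c00] := eqVneq; last by rewrite c00 eqxx in c0.
have := eq_w last_ord; rewrite w_last /= => pos_last {c0 w eq_w w_last}.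
case/and3P: cs pos_last c1 => + _ /eqP; case: s => [|[k c] s] //=.
  by rewrite /total_size /= => _ m0; move: m_gt0; rewrite -m0.
rewrite total_size_cons => /andP[/= k0 s0] size_s.
case: ltnP => [lt_mk /eqP|le_km pos_last]; last first.
  have := @block_pos_lt _ s (m.-1 - k); rewrite pos_last => lt_m.
  have lt_s : (m.-1 - k < total_size s)%N.
    by rewrite ltn_subLR // size_s prednK.
  have := leq_trans (lt_m lt_s); rewrite -size_s.
  move/(_ _ (leqnn _)); rewrite -{1}(prednK k0) addSn /= -{2}[total_size s]add0n.
  by rewrite ltn_add2r.
rewrite -[X in _ == X]addn0 eqn_add2l => /eqP s_nil ->.
have -> : s = [::].
  case: s s0 s_nil {size_s} => //= x s /andP[x0 _] /eqP.
  by rewrite /total_size /= addn_eq0 -leqn0 leqNgt x0.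
by rewrite -size_s s_nil addn0.
Qed.

Lemma composition_single : composition m [:: (m, 1 : F)].
Proof. by rewrite /composition /total_size /= m_gt0 oner_neq0 addn0 eqxx. Qed.

Lemma block_mono_single : block_mono m [:: (m, 1)] = 1%:M :> 'M[F]_m.
Proof.
by apply/matrixP => i j; rewrite !mxE /= ltn_ord addn0 eq_sym.
Qed.

Lemma shalika_sum_mirabolic :
  \sum_(g : {'GL_m[F]}) shalika_sum psi f (ofGL g) *+ (epsilon F m *m ofGL g == epsilon F m)
  = #|F|%:R ^+ (m * m) * f 1%:M.
Proof.
have cs1 := composition_single.
transitivity (\sum_(g in upper_unipotent F m) shalika_sum psi f 1%:M).
  rewrite [RHS]big_mkcond; apply: eq_bigr => g _.
  case: upper_unipotentP => [ug|].
    rewrite epsilon_mulmx row_last_unitriangular // eqxx -[ofGL g]mul1mx mulr1n.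
    by rewrite (shalika_sum_mulr hpsi fW) ?unitmx1.
  move=> nug; case: eqP => // eps_g; apply/eqP; apply/negPn/negP.
  rewrite mulr1n -[ofGL g]invmxK -(ofGLV m_gt0) => /(cell_exists hpsi m_gt0 fW).
  case=> s cs /(cellP _ _ cs)[U uU [V uV def_g]].
  have eps_gV : epsilon F m *m ofGL g^-1%g = epsilon F m.
    by rewrite -[in LHS]eps_g ofGLV // mulmxK ?ofGL_unit.
  have def_s : s = [:: (m, 1)].
    apply: composition_fixing_epsilon cs uV _.
    by rewrite -[in RHS]eps_gV def_g -!mulmxA [RHS]epsilon_unitriangular.
  apply: nug; rewrite -[g]invgK ofGLV // def_g def_s block_mono_single mulmx1.
  by apply/unitriangular_inv/unitriangularM.
rewrite sumr_const (card_unipotent_bin F m_gt0) -[LHS]mulr_natl natrX.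
have := shalika_sum_cell hpsi fW cs1; rewrite big_seq1 block_mono_single invmx1 mulrC => ->.
by rewrite /shalika_mx mul0mx -scalar_mx_block.
Qed.

End Mirabolic.

(** * The shuffle permutation and the reversal *)

Section Sigma.
Variables (F : finFieldType) (m : nat).
Implicit Types A U : 'M[F]_(m + m).

Fact sigma_fun_lt (j : 'I_(m + m)) : (sigma_fun m j < m + m)%N.
Proof.
rewrite /sigma_fun; case: (ltnP j m) => [ltj|lemj]; first by lia.
have := ltn_ord j; lia.
Qed.

Definition sigma_ord j := Ordinal (sigma_fun_lt j).

Lemma sigma_ord_inj : injective sigma_ord.
Proof.
move=> i j /(congr1 val); rewrite /= /sigma_fun => eq_ij; apply: val_inj => /=.
by move: eq_ij; case: ltnP => ?; case: ltnP => ?; lia.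
Qed.

Definition sigma_perm : 'S_(m + m) := perm sigma_ord_inj.

Lemma sigma_mxE : sigma_mx F m = monomial sigma_perm^-1%g (fun=> 1).
Proof.
apply/matrixP => i j; rewrite !mxE -(inj_eq (@perm_inj _ sigma_perm)) permKV permE.
by rewrite eq_sym -val_eqE.
Qed.

Lemma sigma_unitmx : sigma_mx F m \in unitmx.
Proof. by rewrite sigma_mxE monomial_unitmx // => i; apply: oner_neq0. Qed.

Definition sigma_conj A := sigma_mx F m *m A *m invmx (sigma_mx F m).

Lemma sigma_conjE A i j : sigma_conj A (sigma_perm i) (sigma_perm j) = A i j.
Proof.
rewrite /sigma_conj {1}sigma_mxE monomial_conj => [|k]; last exact: oner_neq0.
by rewrite -sigma_mxE mulmxK ?sigma_unitmx // mxE !permK divr1 mul1r.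
Qed.

Lemma sigma_conjM A U : sigma_conj (A *m U) = sigma_conj A *m sigma_conj U.
Proof. by rewrite /sigma_conj !mulmxA mulmxKV ?sigma_unitmx. Qed.

Lemma sigma_conj_unitmx A : A \in unitmx -> sigma_conj A \in unitmx.
Proof. by move=> uA; rewrite !unitmx_mul unitmx_inv sigma_unitmx uA. Qed.

Lemma sigma_perm_lshift (a : 'I_m) : val (sigma_perm (lshift m a)) = a.*2.
Proof. by rewrite permE /= /sigma_fun /= ltn_ord. Qed.

Lemma sigma_perm_rshift (a : 'I_m) : val (sigma_perm (rshift m a)) = a.*2.+1.
Proof. by rewrite permE /= /sigma_fun /= ltnNge leq_addr /= addKn. Qed.

Lemma sigma_conj_unitriangular U :
  shuffled_unipotent U -> unitriangular (sigma_conj U).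
Proof.
rewrite -{2}[U]submxK; case; move: (ulsubmx U) (ursubmx U) (dlsubmx U) (drsubmx U).
move=> A B D E uA uB uD uE i j; rewrite -[ i](permKV sigma_perm) -[j](permKV sigma_perm).
rewrite sigma_conjE (inj_eq perm_inj); move: (_ i) (_ j) => {i j}a b.
case: (split_ordP a) => {}a ->; case: (split_ordP b) => {}b ->;
  rewrite ?sigma_perm_lshift ?sigma_perm_rshift ?(inj_eq (@lshift_inj _ _))
    ?(inj_eq (@rshift_inj _ _)) => le_ba.
- by rewrite block_mxEul uA // -leq_double.
- rewrite block_mxEur uB; last by rewrite -ltn_double; lia.
  by rewrite eq_lrshift.
- rewrite block_mxEdl uD; last by lia.
  by rewrite eq_rlshift.
- by rewrite block_mxEdr uE // -leq_double; lia.
Qed.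

Lemma superdiag_sigma_conj U :
  superdiag (sigma_conj U) = \tr (ursubmx U) + superdiag (dlsubmx U).
Proof.
rewrite -{1}[U]submxK; move: (ulsubmx U) (ursubmx U) (dlsubmx U) (drsubmx U) => A B D E.
rewrite /superdiag (reindex_inj (@perm_inj _ sigma_perm)) big_split_ord /=; congr (_ + _).
  apply: eq_bigr => a _.
  rewrite (reindex_inj (@perm_inj _ sigma_perm)) big_mkcond big_split_ord /=.
  rewrite big1 ?add0r => [|b _]; last first.
    by rewrite (sigma_perm_lshift a) (sigma_perm_lshift b); case: eqP => //; lia.
  rewrite (bigD1 a) //= sigma_perm_lshift sigma_perm_rshift eqxx sigma_conjE block_mxEur.
  rewrite big1 ?addr0 // => b; rewrite -val_eqE /= => ne_ba.
  by rewrite sigma_perm_rshift; case: eqP => //; lia.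
apply: eq_bigr => a _.
rewrite (reindex_inj (@perm_inj _ sigma_perm)) big_mkcond big_split_ord /=.
rewrite [X in _ + X]big1 ?addr0 => [|b _]; last first.
  by rewrite (sigma_perm_rshift a) (sigma_perm_rshift b); case: eqP => //; lia.
rewrite [RHS]big_mkcond; apply: eq_bigr => b _.
rewrite sigma_perm_rshift sigma_perm_lshift sigma_conjE block_mxEdl.
by have -> : (b.*2 == a.*2.+2) = (val b == a.+1) by apply/eqP/eqP => /=; lia.
Qed.

End Sigma.

Section Reversal.
Variables (F : finFieldType) (n : nat).
Implicit Types A : 'M[F]_n.

Definition antitranspose A := antidiag1_mx F n *m A^T *m antidiag1_mx F n.

Lemma antidiag1_mull k (A : 'M[F]_(n, k)) i j :
  (antidiag1_mx F n *m A) i j = A (rev_ord i) j.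
Proof.
rewrite mxE (bigD1 (rev_ord i)) //= mxE eqxx mul1r big1 ?addr0 // => l /negPf nl.
by rewrite mxE nl mul0r.
Qed.

Lemma antidiag1_mulr k (A : 'M[F]_(k, n)) i j :
  (A *m antidiag1_mx F n) i j = A i (rev_ord j).
Proof.
rewrite mxE (bigD1 (rev_ord j)) //= mxE rev_ordK eqxx mulr1 big1 ?addr0 // => l nl.
rewrite mxE; case: eqP => [def_j|_]; last by rewrite mulr0.
by rewrite def_j rev_ordK eqxx in nl.
Qed.

Lemma antidiag1_sq : antidiag1_mx F n *m antidiag1_mx F n = 1%:M.
Proof. by apply/matrixP => i j; rewrite antidiag1_mull !mxE rev_ordK eq_sym. Qed.

Lemma antidiag1_unitmx : antidiag1_mx F n \in unitmx.
Proof. by case: (mulmx1_unit antidiag1_sq). Qed.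

Lemma antitransposeE A i j : antitranspose A i j = A (rev_ord j) (rev_ord i).
Proof. by rewrite antidiag1_mulr antidiag1_mull mxE. Qed.

Lemma antitransposeK : involutive antitranspose.
Proof. by move=> A; apply/matrixP => i j; rewrite !antitransposeE !rev_ordK. Qed.

Lemma antitranspose_unitriangular A : unitriangular A -> unitriangular (antitranspose A).
Proof.
move=> uA i j leji; rewrite antitransposeE uA ?(inj_eq rev_ord_inj) 1?eq_sym //=.
by apply: leq_sub2l.
Qed.

Lemma antitranspose_upper A : upper A -> upper (antitranspose A).
Proof.
move=> uA i j ltji; rewrite antitransposeE uA //=.
by have := ltn_ord i; lia.
Qed.

Lemma mxtrace_antitranspose A : \tr (antitranspose A) = \tr A.
Proof. by rewrite mxtrace_mulC mulmxA antidiag1_sq mul1mx mxtrace_tr. Qed.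

End Reversal.

(** The shuffle commutes with the reversal of all positions. *)
Lemma sigma_antidiag1 (F : finFieldType) m :
  sigma_mx F m *m antidiag1_mx F (m + m) *m (sigma_mx F m)^T = antidiag1_mx F (m + m).
Proof.
have trE (A : 'M[F]_(m + m)) : A *m (sigma_mx F m)^T = (sigma_mx F m *m A^T)^T.
  by rewrite trmx_mul trmxK.
apply/matrixP => i j; rewrite trE mxE sigma_mxE monomial_mull mul1r mxE.
rewrite monomial_mull mul1r !mxE -[i in RHS](permKV (sigma_perm m)) -[j in RHS](permKV (sigma_perm m)).
move: (_ i) (_ j) => a b; rewrite -!val_eqE /= !permE /= /sigma_fun.
have := ltn_ord a; have := ltn_ord b.
by case: (ltnP b m) => ?; case: (ltnP a m) => ? ? ?; congr (nat_of_bool _)%:R;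
  apply/eqP/eqP; lia.
Qed.

Lemma block_antidiag1 (F : finFieldType) m :
  block_mx 0 (antidiag1_mx F m) (antidiag1_mx F m) 0 = antidiag1_mx F (m + m).
Proof.
apply/matrixP => i j; case: (split_ordP i) => a ->; case: (split_ordP j) => b ->;
  rewrite ?block_mxEul ?block_mxEur ?block_mxEdl ?block_mxEdr !mxE -!val_eqE /=;
  have := ltn_ord a; have := ltn_ord b => *.
- by case: eqP => //; lia.
- by congr (nat_of_bool _)%:R; apply/eqP/eqP; lia.
- by congr (nat_of_bool _)%:R; apply/eqP/eqP; lia.
- by case: eqP => //; lia.
Qed.

(** * From sums over cosets to sums over the group *)

Section CosetSums.
Variables (C : numClosedFieldType) (F : finFieldType) (m : nat).
Hypothesis m_gt0 : (0 < m)%N.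

(** The second hypothesis only concerns the sum over [X], because translating [g]
    on the left by N conjugates [X] by an element of N. *)
Lemma sum_double_rcosets (t : {'GL_m[F]} -> 'M[F]_m -> C) :
    (forall g T X, upper T -> t g (T + X) = t g X) ->
    (forall u g, unitriangular (ofGL u) -> \sum_X t (u * g)%g X = \sum_X t g X) ->
  (#|[set: {'GL_m[F]}] : upper_unipotent F m|%g%:R
     * #|[set: 'M[F]_m] : upper_triangular F m|%g%:R)^-1
  * (\sum_(Ng in rcosets (upper_unipotent F m) [set: {'GL_m[F]}])
      \sum_(BX in rcosets (upper_triangular F m) [set: 'M[F]_m])
        t (repr Ng) (repr BX))
  = (#|[set: {'GL_m[F]}]|%:R * #|[set: 'M[F]_m]|%:R)^-1 * \sum_g \sum_X t g X.
Proof.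
move=> tT tN; pose N := upper_unipotent_group F m_gt0.
pose B := upper_triangular_group F m.
have natr_neq0 (gT : finGroupType) (H : {group gT}) : #|H|%:R != 0 :> C.
  by rewrite pnatr_eq0 -lt0n cardG_gt0.
transitivity ((#|[set: {'GL_m[F]}] : N|%g%:R * #|[set: 'M[F]_m] : B|%g%:R)^-1
    * ((#|N|%:R)^-1 * ((#|B|%:R)^-1 * \sum_g \sum_X t g X))).
  congr (_ * _); rewrite mulr_sumr -(@sum_rcosets _ _ N) => [|u g /upper_unipotentP uu].
    apply: eq_bigr => Ng _; rewrite -(@sum_rcosets _ _ B) // => T X /upper_triangularP uT.
    exact: tT.
  by rewrite tN.
rewrite -(Lagrange (subsetT N)) -(Lagrange (subsetT B)) !natrM !mulrA; congr (_ * _).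
have regroup (a b c d : C) : (a * b)^-1 / c / d = (c * a * d * b)^-1.
  by rewrite -!invfM; congr (_^-1); ring.
exact: regroup.
Qed.

End CosetSums.

(** * The functional equation at a translated Bessel function *)

Section BesselSums.
Variables (C : numClosedFieldType) (F : finFieldType) (psi : F -> C) (m : nat).
Hypothesis hpsi : nontrivial_additive_character psi.
Hypothesis m_gt0 : (0 < m)%N.
Variable B : {'GL_(m + m)[F]} -> C.
Hypothesis B_equiv :
  forall u1 g u2, u1 \in upper_unipotent F (m + m) -> u2 \in upper_unipotent F (m + m) ->
    B (u1 * g * u2)%g = psi_unip psi u1 * psi_unip psi u2 * B g.

Let mm_gt0 : (0 < m + m)%N. Proof. by rewrite addn_gt0 m_gt0. Qed.
Let ilast := last_ord m_gt0.
Let ifirst : 'I_m := Ordinal m_gt0.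

Definition shuffled_bessel (A : 'M[F]_(m + m)) : C := B (toGL (sigma_conj A)).

Lemma psi_unipE n (u : {'GL_n[F]}) : psi_unip psi u = psi (superdiag (ofGL u)).
Proof. by []. Qed.

Lemma shuffled_besselP : shuffled_whittaker psi shuffled_bessel.
Proof.
move=> U h V sU uh sV; have uU := sigma_conj_unitriangular sU.
have uV := sigma_conj_unitriangular sV.
have UU := unitriangular_unitmx uU; have UV := unitriangular_unitmx uV.
have Uh := sigma_conj_unitmx uh.
have toGLM3 (P Q T : 'M[F]_(m + m)) : P \in unitmx -> Q \in unitmx -> T \in unitmx ->
    toGL (P *m Q *m T) = (toGL P * toGL Q * toGL T)%g :> {'GL_(m + m)[F]}.
  by move=> uP uQ uT; rewrite !toGLM // unitmx_mul uP.
rewrite /shuffled_bessel !sigma_conjM toGLM3 //.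
rewrite B_equiv; try by apply/upper_unipotentP; rewrite toGLK.
by rewrite !psi_unipE !toGLK // !superdiag_sigma_conj.
Qed.

Let f := shuffled_bessel.
Let W (h : {'GL_(m + m)[F]}) : C := B (h * (toGL (sigma_mx F m))^-1)%g.
Let delta (x : 'rV[F]_m) : C := (x == epsilon F m)%:R.

Lemma shuffled_besselE A : A \in unitmx -> W (toGL (sigma_mx F m *m A)) = f A.
Proof.
move=> uA; rewrite /W -toGLV ?sigma_unitmx // -toGLM //.
  by rewrite unitmx_mul sigma_unitmx.
by rewrite unitmx_inv sigma_unitmx.
Qed.

Lemma sigma_shalika g X : g \in unitmx ->
  W (toGL (sigma_mx F m *m block_mx 1%:M X 0 1%:M *m block_mx g 0 0 g))
  = f (shalika_mx g X).
Proof.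
move=> ug; rewrite -mulmxA mulmx_block !mul1mx !mulmx0 !mul0mx !addr0 !add0r.
by rewrite shuffled_besselE //; apply: shalika_unitmx.
Qed.

Lemma JS_delta :
  JS psi W delta = (#|[set: {'GL_m[F]}]|%:R * #|[set: 'M[F]_m]|%:R)^-1
    * (#|F|%:R ^+ (m * m) * f 1%:M).
Proof.
pose t (g : {'GL_m[F]}) X := shalika_term psi f (ofGL g) X * delta (epsilon F m *m ofGL g).
have -> : JS psi W delta = (#|[set: {'GL_m[F]}] : upper_unipotent F m|%g%:R
     * #|[set: 'M[F]_m] : upper_triangular F m|%g%:R)^-1
  * (\sum_(Ng in rcosets (upper_unipotent F m) [set: {'GL_m[F]}])
      \sum_(BX in rcosets (upper_triangular F m) [set: 'M[F]_m])
        t (repr Ng) (repr BX)).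
  congr (_ * _); apply: eq_bigr => Ng _; apply: eq_bigr => BX _ /=.
  by rewrite sigma_shalika ?ofGL_unit.
rewrite sum_double_rcosets //.
- rewrite -(shalika_sum_mirabolic hpsi m_gt0 shuffled_besselP).
  congr (_ * _); apply: eq_bigr => g _; rewrite -mulr_suml -mulr_natr.
  by congr (_ * _).
- move=> g T X uT; rewrite /t (shalika_term_upper hpsi shuffled_besselP) //.
  exact: ofGL_unit.
move=> u g uu; rewrite -!mulr_suml (ofGLM m_gt0 u g) epsilon_unitriangular //.
by rewrite [X in X * _](shalika_sum_mull hpsi shuffled_besselP) ?ofGL_unit.
Qed.

Lemma epsilon_unipotent (u g : {'GL_m[F]}) : unitriangular (ofGL u) ->
  epsilon F m *m ofGL (u * g)%g = epsilon F m *m ofGL g.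
Proof. by move=> uu; rewrite ofGLM // epsilon_unitriangular. Qed.

Let flip (g : {'GL_m[F]}) : {'GL_m[F]} := toGL (antidiag1_mx F m *m (invmx (ofGL g))^T).

Lemma ofGL_flip g : ofGL (flip g) = antidiag1_mx F m *m (invmx (ofGL g))^T.
Proof. by rewrite toGLK // unitmx_mul antidiag1_unitmx unitmx_tr unitmx_inv ofGL_unit. Qed.

Lemma flip_tr g : ofGL (flip g) *m (ofGL g)^T = antidiag1_mx F m.
Proof.
by rewrite ofGL_flip -mulmxA -trmx_mul mulmxV ?ofGL_unit // trmx1 mulmx1.
Qed.

Lemma flip_inj : injective flip.
Proof.
move=> g h eq_gh; apply: (ofGL_inj m_gt0); apply: trmx_inj.
by apply: (can_inj (mulKmx (ofGL_unit m_gt0 (flip g)))); rewrite flip_tr eq_gh flip_tr.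
Qed.

(** Transposing the inverse turns (1 X; 0 1) into (1 0; -X^T 1), and the block
    swap together with the reversal r brings it back to upper triangular form, with
    r g^-T for g and - r X^T r for X. *)
Lemma dual_term g X :
  right_translate (toGL (block_mx 0 1%:M 1%:M 0 : 'M[F]_(m + m))) (tildeW W)
    (toGL (sigma_mx F m *m block_mx 1%:M X 0 1%:M *m block_mx (ofGL g) 0 0 (ofGL g)))
  = f (shalika_mx (ofGL (flip g)) (- antitranspose X)).
Proof.
have ug := ofGL_unit m_gt0 g; set J := block_mx 0 1%:M 1%:M 0.
have uJ : J \in unitmx.
  suff : J *m J = 1%:M by case/mulmx1_unit.
  by rewrite mulmx_block !mulmx0 !mul0mx !mulmx1 !add0r !addr0 -scalar_mx_block.
have -> : sigma_mx F m *m block_mx 1%:M X 0 1%:M *m block_mx (ofGL g) 0 0 (ofGL g)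
    = sigma_mx F m *m shalika_mx (ofGL g) X.
  by rewrite -mulmxA mulmx_block !mul1mx !mulmx0 !mul0mx !addr0 !add0r.
set S := sigma_mx F m *m _.
have uS : S \in unitmx by rewrite unitmx_mul sigma_unitmx shalika_unitmx.
rewrite /right_translate /tildeW -toGLM // toGLK ?unitmx_mul ?uS //.
rewrite -shuffled_besselE ?shalika_unitmx ?ofGL_unit //; congr (W (toGL _)).
have uSJ : (S *m J)^T \in unitmx by rewrite unitmx_tr unitmx_mul uS.
apply: (can_inj (mulmxK uSJ)); rewrite trmx_inv mulmxKV //.
rewrite trmx_mul /S trmx_mul -[LHS]sigma_antidiag1 !mulmxA; congr (_ *m _).
rewrite -!mulmxA; congr (_ *m _).
rewrite /J /shalika_mx !tr_block_mx !trmx0 !trmx1 !mulmx_block.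
rewrite !mulmx0 !mul0mx !mul1mx !add0r !addr0 flip_tr trmx_mul.
rewrite mulmxA flip_tr -mulmxA flip_tr -block_antidiag1 /antitranspose mulNmx.
  by rewrite -!mulmxA antidiag1_sq mulmx1 subrr !mulmx0 addr0.
by rewrite sigma_unitmx shalika_unitmx ?uJ.
Qed.

Lemma fourier_delta y : fourier psi delta y = sqrtq C F ^- m * psi (y 0 ilast).
Proof.
rewrite /fourier (bigD1 (epsilon F m)) //= {1}/delta eqxx mul1r big1 ?addr0 => [|x /negPf nx].
  by rewrite epsilon_mulmx !mxE.
by rewrite /delta nx mul0r.
Qed.

Lemma JS_dual_delta :
  JS_dual psi W delta = (#|[set: {'GL_m[F]}]|%:R * #|[set: 'M[F]_m]|%:R)^-1
    * (sqrtq C F ^- m * \sum_(g : {'GL_m[F]})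
         shalika_sum psi f (invmx (ofGL g)) * psi (ofGL g ilast ifirst)).
Proof.
pose t (g : {'GL_m[F]}) X := shalika_term psi f (ofGL (flip g)) (- antitranspose X)
  * fourier psi delta (epsilon F m *m ofGL g).
have -> : JS_dual psi W delta = (#|[set: {'GL_m[F]}] : upper_unipotent F m|%g%:R
     * #|[set: 'M[F]_m] : upper_triangular F m|%g%:R)^-1
  * (\sum_(Ng in rcosets (upper_unipotent F m) [set: {'GL_m[F]}])
      \sum_(BX in rcosets (upper_triangular F m) [set: 'M[F]_m])
        t (repr Ng) (repr BX)).
  congr (_ * _); apply: eq_bigr => Ng _; apply: eq_bigr => BX _ /=.
  rewrite dual_term /t /shalika_term; congr (_ * _ * _).
  by rewrite linearN /= mxtrace_antitranspose opprK /char_inv -psiN // opprK.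
have sum_t g : \sum_X t g X = shalika_sum psi f (ofGL (flip g))
    * fourier psi delta (epsilon F m *m ofGL g).
  rewrite -mulr_suml; congr (_ * _).
  rewrite /shalika_sum [RHS](reindex_inj (h := fun X => - antitranspose X)) //.
  by move=> X Y /oppr_inj/(can_inj (@antitransposeK _ _)).
rewrite sum_double_rcosets //.
- congr (_ * _); rewrite mulr_sumr.
  rewrite [RHS](reindex_inj (h := fun g => (flip g)^-1%g)) => [|g h /invg_inj/flip_inj //].
  apply: eq_bigr => g _; rewrite sum_t ofGLV // invmxK fourier_delta mulrCA.
  congr (_ * (_ * psi _)); rewrite epsilon_mulmx mxE.
  have -> : ofGL g ilast ilast = (ofGL g)^T ilast ilast by rewrite mxE.
  have -> : (ofGL g)^T = invmx (ofGL (flip g)) *m antidiag1_mx F m.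
    by rewrite -(flip_tr g) mulKmx ?ofGL_unit.
  rewrite antidiag1_mulr; congr (_ _ _); apply: val_inj => /=.
  by rewrite prednK // subnn.
- move=> g T X uT; rewrite /t; congr (_ * _).
  have -> : - antitranspose (T + X) = - antitranspose T - antitranspose X.
    by rewrite /antitranspose linearD mulmxDr mulmxDl opprD.
  apply: (shalika_term_upper hpsi shuffled_besselP); first exact: ofGL_unit.
  by move=> i j ltji; rewrite mxE (antitranspose_upper uT) ?oppr0.
move=> u g uu; have Uu := unitriangular_unitmx uu.
have flip_u : ofGL (flip (u * g)%g) = antitranspose (invmx (ofGL u)) *m ofGL (flip g).
  rewrite !ofGL_flip (ofGLM m_gt0 u g) invmx_mul ?ofGL_unit // trmx_mul /antitranspose.
  by rewrite -!mulmxA (mulmxA (antidiag1_mx F m) (antidiag1_mx F m)) antidiag1_sq mul1mx.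
have sum_u : shalika_sum psi f (ofGL (flip (u * g)%g)) = shalika_sum psi f (ofGL (flip g)).
  rewrite flip_u (shalika_sum_mull hpsi shuffled_besselP) ?ofGL_unit //.
  exact/antitranspose_unitriangular/unitriangular_inv.
apply: etrans (sum_t _) _; apply: etrans _ (esym (sum_t _)).
exact: (congr2 (fun x y => x * fourier psi delta y) sum_u (epsilon_unipotent g uu)).
Qed.

Lemma gamma_bessel_sum gamma : B 1%g = 1 ->
    JS_dual psi W delta = gamma * JS psi W delta ->
  gamma = sqrtq C F ^- m * #|F|%:R ^+ (2 * 'C(m, 2))
    * \sum_(1 <= r < m.+1)
        \sum_(ms : r.-tuple 'I_m.+1
           | all (fun k : 'I_m.+1 => 0 < k)%N ms && (\sum_(k <- ms) k == m)%N)
        \sum_(la : r.-tuple F | all (fun x => x != 0) la)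
          let s := zip (map val ms) la in
          #|F|%:R ^- (\sum_(x <- s) 2 * 'C(x.1, 2))%N
          * f (shalika_mx (invmx (block_mono m s)) 0) * psi (block_mono m s ilast ifirst).
Proof.
move=> B1; rewrite JS_delta JS_dual_delta; have natr0 n : #|F|%:R ^+ n != 0 :> C by apply: natrq_neq0.
rewrite (shalika_sum_total hpsi m_gt0 shuffled_besselP (phi := fun A => psi (A ilast ifirst))); last first.
  move=> U A V uU uV; congr psi.
  transitivity ((row ilast (U *m A *m V)) 0 ifirst); first by rewrite [RHS]mxE.
  rewrite -mulmxA row_mul row_last_unitriangular // epsilon_mulmx mxE.
  rewrite mxE (bigD1 ifirst) //= unitriangular_diag // mulr1 big1 ?addr0 // => k nk.
  rewrite (unitriangular_upper uV) ?mulr0 // lt0n; apply: contraNneq nk => k0.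
  by apply/eqP/val_inj.
have -> : f 1%:M = 1.
  by rewrite /f /shuffled_bessel /sigma_conj mulmx1 mulmxV ?sigma_unitmx // -(ofGL1 F mm_gt0) ofGLK.
set S := \sum_(1 <= r < m.+1) _.
have card_neq0 (gT : finGroupType) : #|[set: gT]|%:R != 0 :> C.
  by rewrite pnatr_eq0 -lt0n cardG_gt0.
have K0 : (#|[set: {'GL_m[F]}]|%:R * #|[set: 'M[F]_m]|%:R)^-1 != 0 :> C.
  by rewrite invr_eq0; apply: mulf_neq0; apply: card_neq0.
rewrite [gamma * _]mulrCA => /(mulfI K0); rewrite mulr1 => eq_gamma.
apply: (mulIf (natr0 (m * m)%N)); rewrite -eq_gamma exprD.
by ring.
Qed.

End BesselSums.

(** * Bessel values at block antidiagonal matrices *)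

Lemma toGL_castmx (F : finFieldType) n k (e : k = n) (A : 'M[F]_k) :
  toGL A = toGL (castmx (e, e) A) :> {'GL_n[F]}.
Proof. by case: n / e. Qed.

Section BlockValue.
Variables (F : finFieldType) (m : nat).
Hypothesis m_gt0 : (0 < m)%N.
Implicit Types s : seq (nat * F).

Lemma sigma_conj_diag s i j : composition m s ->
  sigma_conj (block_mx (block_mono m s) 0 0 (block_mono m s)) i j
  = block_coef [seq ((2 * x.1)%N, x.2) | x <- s] i
      *+ (val j == block_pos [seq ((2 * x.1)%N, x.2) | x <- s] i).
Proof.
case/and3P => _ _ /eqP size_s.
rewrite -[ i](permKV (sigma_perm m)) -[j](permKV (sigma_perm m)) sigma_conjE.
move: (_ i) (_ j) => {i j}a b.
have lts (k : 'I_m) : (k < total_size s)%N by rewrite size_s.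
set s2 := [seq _ | x <- s].
have pos0 (k : 'I_m) : block_pos s2 k.*2 = (block_pos s k).*2.
  exact: (block_pos_double false (lts k)).
have pos1 (k : 'I_m) : block_pos s2 k.*2.+1 = (block_pos s k).*2.+1.
  exact: (block_pos_double true (lts k)).
have coef0 (k : 'I_m) : block_coef s2 k.*2 = block_coef s k.
  exact: (block_coef_double false (lts k)).
have coef1 (k : 'I_m) : block_coef s2 k.*2.+1 = block_coef s k.
  exact: (block_coef_double true (lts k)).
case: (split_ordP a) => {}a ->; case: (split_ordP b) => {}b ->;
  rewrite ?sigma_perm_lshift ?sigma_perm_rshift.
- by rewrite pos0 coef0 block_mxEul mxE (inj_eq double_inj).
- by rewrite pos0 block_mxEur mxE; case: eqP => //; lia.
- by rewrite pos1 block_mxEdl mxE; case: eqP => //; lia.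
- by rewrite pos1 coef1 block_mxEdr mxE eqSS (inj_eq double_inj).
Qed.

(** The shuffle takes each pair of equal blocks lambda_i 1_(m_i) of diag(T, T) to
    the single block lambda_i 1_(2 m_i). *)
Lemma toGL_even_antidiag ms la : composition m (zip ms la) ->
  toGL (antidiag (even_scalar_blocks ms la))
  = toGL (sigma_conj (block_mx (block_mono m (zip ms la)) 0 0 (block_mono m (zip ms la))))
    :> {'GL_(m + m)[F]}.
Proof.
move=> cs; have /and3P[_ _ /eqP size_s] := cs.
rewrite even_scalar_blocksE; set s2 := [seq ((2 * x.1)%N, x.2) | x <- _].
have e : sumn [seq tag g | g <- scalar_blocks s2] = (m + m)%N.
  by rewrite -map_comp addnn -mul2n -[in RHS]size_s -total_size_double.
rewrite (toGL_castmx e); congr toGL; apply/matrixP => i j.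
by rewrite castmxE antidiag_scalar_blocks sigma_conj_diag.
Qed.

Lemma sigma_conj_diag_unitmx s : composition m s ->
  block_mx (block_mono m s) 0 0 (block_mono m s) \in unitmx.
Proof. by move=> cs; rewrite unitmxE det_ublock unitrM -!unitmxE block_mono_unitmx. Qed.

Lemma toGL_even_antidiagV ms la : composition m (zip ms la) ->
  (toGL (antidiag (even_scalar_blocks ms la)))^-1%g
  = toGL (sigma_conj (shalika_mx (invmx (block_mono m (zip ms la))) 0))
    :> {'GL_(m + m)[F]}.
Proof.
move=> cs; have mm_gt0 : (0 < m + m)%N by rewrite addn_gt0 m_gt0.
have uD := sigma_conj_diag_unitmx cs; have uT := block_mono_unitmx cs.
rewrite toGL_even_antidiag // -toGLV ?sigma_conj_unitmx //; congr toGL.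
apply: (can_inj (mulKmx (sigma_conj_unitmx uD))).
rewrite mulmxV ?sigma_conj_unitmx // -sigma_conjM /shalika_mx mul0mx mulmx_block.
rewrite !mulmx0 !mul0mx !addr0 !add0r !mulmxV // -scalar_mx_block.
by rewrite /sigma_conj mulmx1 mulmxV ?sigma_unitmx.
Qed.

End BlockValue.

Local Open Scope complex_scope.

Theorem theorem2p31 (R : realType) (F : finFieldType) (psi : F -> R[i])
    (hpsi : nontrivial_additive_character psi)
    (m : nat) (hm : (0 < m)%N)
    (d : nat) (pi : mx_representation R[i] [set: {'GL_(m + m)[F]}] d)
    (hirr : mx_irreducible pi) (hcusp : cuspidal pi)
    (hshalika : ~ exists v : 'cV[R[i]]_d, shalika_vector psi pi v)
    (gamma : R[i]) (hgamma : exterior_square_gamma psi pi gamma)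
    (B : {'GL_(m + m)[F]} -> R[i]) (hB : bessel_function psi pi B) :
  gamma =
    sqrtq R[i] F ^- m * #|F|%:R ^+ (2 * 'C(m, 2))
    * \sum_(1 <= r < m.+1)
      \sum_(ms : r.-tuple 'I_m.+1
              | all (fun k : 'I_m.+1 => 0 < k)%N ms
                && (\sum_(k <- ms) k == m)%N)
      \sum_(la : r.-tuple F | all (fun x => x != 0) la)
        #|F|%:R ^- (\sum_(k <- ms) 2 * 'C(k, 2))%N
        * B (toGL (antidiag (even_scalar_blocks (map val ms) la)))^-1%g
        * psi (last 0 la * (last 0%N (map val ms) == 1%N)%:R).
Proof.
have [[l [l0 lW [v Bv]]] B1 B_equiv] := hB.
pose W (h : {'GL_(m + m)[F]}) := B (h * (toGL (sigma_mx F m))^-1)%g.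
have modW : whittaker_model psi pi W.
  exists l; split=> //; exists (pi (toGL (sigma_mx F m))^-1%g *m v) => g.
  by rewrite /W Bv repr_mxM ?inE // !mulmxA.
have := hgamma.2 W _ modW => /(_ (fun x => (x == epsilon F m)%:R)).
move/(gamma_bessel_sum hpsi hm B_equiv B1) => ->.
congr (_ * _); apply: eq_big_nat => r /andP[r_gt0 _].
apply: eq_bigr => ms ms_ok; apply: eq_bigr => la la_ok /=.
have cs := composition_zip ms_ok la_ok.
have eq_size : size (map val ms) = size la by rewrite size_map !size_tuple.
rewrite /shuffled_bessel -toGL_even_antidiagV //.
have -> : (\sum_(x <- zip (map val ms) la) 2 * 'C(x.1, 2) = \sum_(k <- ms) 2 * 'C(k, 2))%N.
  rewrite -(big_map fst xpredT (fun k => 2 * 'C(k, 2))%N) -/(unzip1 _).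
  by rewrite unzip1_zip ?eq_size // big_map.
congr (_ * psi _); have /and3P[s_gt0 _ /eqP size_s] := cs.
have := block_corner _ s_gt0; rewrite size_s size_zip size_map !size_tuple minnn.
by rewrite unzip1_zip ?unzip2_zip ?eq_size // mxE => <-.
Qed.
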